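(* For all real numbers $\alpha,\beta>0$, let $X_{\alpha,\beta}$ be a Gamma random variable with shape parameter $\alpha$ and scale parameter $\beta$, and let $Z$ be a standard normal random variable. Then, for all $\alpha,\beta>0$, $$P\left\{|X_{\alpha,\beta}-E[X_{\alpha,\beta}]|\le \sqrt{\mathrm{Var}(X_{\alpha,\beta})}\right\}>P\{|Z|\le 1\}\approx 0.6826,$$ and $$\inf_{\alpha>0,\,\beta>0}P\left\{|X_{\alpha,\beta}-E[X_{\alpha,\beta}]|\le \sqrt{\mathrm{Var}(X_{\alpha,\beta})}\right\}=P\{|Z|\le 1\}.$$
   Context: A Gamma random variable $X_{\alpha,\beta}$ with shape parameter $\alpha>0$ and scale parameter $\beta>0$ has probability density function $f_{\alpha,\beta}(x)=\dfrac{x^{\alpha-1}e^{-x/\beta}}{\Gamma(\alpha)\beta^{\alpha}}$ for $x>0$ (and $0$ otherwise). Here $P$, $E$ and $\mathrm{Var}$ denote probability, expectation and variance. The expression ''$\approx 0.6826$'' only indicates the numerical value of $P\{|Z|\le 1\}$. *)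

(* Defs.v *)
From mathcomp Require Export all_boot all_order all_algebra.
From mathcomp Require Export all_classical all_reals all_analysis.
Export Order.TTheory GRing.Theory Num.Theory.
Export numFieldNormedType.Exports.

Set Implicit Arguments.
Unset Strict Implicit.
Unset Printing Implicit Defensive.

Local Open Scope classical_set_scope.
Local Open Scope ring_scope.

Definition gamma_fun {R : realType} (a : R) : R :=
  \int[lebesgue_measure]_(x in `]0, +oo[) (x `^ (a - 1) * expR (- x)).

Definition gamma_pdf {R : realType} (a b : R) : R -> R :=
  (fun x => x `^ (a - 1) * expR (- (x / b)) / (gamma_fun a * b `^ a))
    \_ `]0, +oo[.

Definition has_density {R : realType} {d : measure_display}
    {T : measurableType d} (P : probability T R) (X : {RV P >-> R})
    (f : R -> R) : Prop :=
  forall A : set R, measurable A ->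
    distribution P X A = (\int[lebesgue_measure]_(x in A) (f x)%:E)%E.

(* [b] is the scale, not the rate. *)
Definition gamma_rv {R : realType} {d : measure_display}
    {T : measurableType d} (P : probability T R) (X : {RV P >-> R})
    (a b : R) : Prop :=
  has_density X (gamma_pdf a b).

Definition std_normal_rv {R : realType} {d : measure_display}
    {T : measurableType d} (P : probability T R) (Z : {RV P >-> R}) : Prop :=
  has_density Z (normal_pdf 0 1).

(* ['E_P[X]] and ['V_P[X]] are extended reals, so the deviation is compared in
   [\bar R] instead of truncating them with [fine]. *)
Definition within_one_sd {R : realType} {d : measure_display}
    {T : measurableType d} (P : probability T R) (X : {RV P >-> R}) : set T :=
  [set w | (`|(X w)%:E - 'E_P[X]| <= sqrte 'V_P[X])%E].

(* Main.v *)
Require Import Defs.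
From mathcomp Require Import measurable_realfun ring lra.

(** Let s = sqrt a, k = 1 / sqrt (2 pi), and write x = b (s^2 + s y). The
    density of the standardised variable is h(y) / r(a) on ]-s, +oo[, with
    h(y) = (1 + y/s)^(a-1) e^(-s y) and r(a) = Gamma(a+1) e^a / a^(a+1/2).

    Stirling: r(a) is the integral of (1 + y/s)^a e^(-s y), so r(a+n) tends to
    1/k by dominated convergence. Since ln (r(a) / r(a+1)) =
    (a + 1/2) ln (1 + 1/a) - 1 lies between 0 and (1/a - 1/(a+1)) / 12, it
    follows that 1/k <= r(a) <= e^(1/(12 a)) / k.

    For a > 1, AM-GM gives h(y) + h(-y) >= 2 (1 - y^2/a)^((a-1)/2), and an
    elementary bound on the logarithm turns this into
    (h(y) + h(-y)) / r(a) >= 2 k e^(-y^2/2) (1 + (6 y^2 - 3 y^4 - 1) / (12 a))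
    on [0, 1]; the integral of e^(-y^2/2) (6 y^2 - 3 y^4 - 1) over [0, 1] is
    6 e^(-1/2) - 4 int_0^1 e^(-y^2/2) > 0.

    For a <= 1, integration by parts bounds the tail beyond b (a + s) by a
    third of the head, so the probability is at least 3/4, whereas
    P(|Z| <= 1) <= 7/10.

    The infimum is approached as a tends to +oo, since h(y) <= e^(2/s) e^(-y^2/2)
    on [-1, 1] and 1 / r(a) <= k. *)

Set Implicit Arguments.
Unset Strict Implicit.
Unset Printing Implicit Defensive.

Local Open Scope classical_set_scope.
Local Open Scope ring_scope.

(** * Bounds on the logarithm *)

(** Mean value theorem. It reduces the bounds on [ln] below to the sign of an explicit rational
    derivative. *)
Lemma is_derive_ge0_le (R : realType) (f df : R -> R) (a b : R) : a <= b ->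
  (forall x, a <= x <= b -> is_derive x 1 f (df x)) ->
  (forall x, a <= x <= b -> 0 <= df x) -> f a <= f b.
Proof.
move=> ab fdf df0.
have [] := @MVT_segment R f df a b ab.
- by move=> x; rewrite in_itv/= => /andP[ax xb]; apply: fdf; rewrite !ltW.
- apply: derivable_within_continuous => x; rewrite in_itv/= => xab.
  by have [] := fdf x xab.
move=> c; rewrite in_itv/= => cab E.
by rewrite -subr_ge0 E mulr_ge0 ?df0// subr_ge0.
Qed.

(** * Derivative rules for functions written pointwise *)

Section pointful_derivatives.
Variable R : realType.
Implicit Types (f g : R -> R) (x df dg k : R).

Lemma is_derive1_cstf k x : is_derive x 1 (fun _ : R => k) 0.
Proof. exact: is_derive_cst. Qed.

Lemma is_derive1_idf x : is_derive x 1 (fun y : R => y) 1.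
Proof. exact: is_derive_id. Qed.

Lemma is_derive1_Df f g x df dg : is_derive x 1 f df -> is_derive x 1 g dg ->
  is_derive x 1 (fun y => f y + g y) (df + dg).
Proof. exact: is_deriveD. Qed.

Lemma is_derive1_Nf f x df : is_derive x 1 f df ->
  is_derive x 1 (fun y => - f y) (- df).
Proof. exact: is_deriveN. Qed.

Lemma is_derive1_Mf f g x df dg : is_derive x 1 f df -> is_derive x 1 g dg ->
  is_derive x 1 (fun y => f y * g y) (f x * dg + g x * df).
Proof. exact: is_deriveM. Qed.

Lemma is_derive1_Xf f n x df : is_derive x 1 f df ->
  is_derive x 1 (fun y => f y ^+ n) (n%:R * f x ^+ n.-1 * df).
Proof.
move=> dfx; rewrite (_ : (fun y => f y ^+ n) = f ^+ n); first exact: is_deriveX.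
by apply/funext => y; rewrite exprfctE.
Qed.

Lemma is_derive1_Vf f x df : f x != 0 -> is_derive x 1 f df ->
  is_derive x 1 (fun y => (f y)^-1) (- f x ^- 2 * df).
Proof. by move=> fx0 dfx; exact: is_deriveV. Qed.

Lemma is_derive1_expRf f x df : is_derive x 1 f df ->
  is_derive x 1 (fun y => expR (f y)) (df * expR (f x)).
Proof. by move=> dfx; rewrite mulrC; apply: is_derive1_comp. Qed.

Lemma is_derive1_lnf f x df : 0 < f x -> is_derive x 1 f df ->
  is_derive x 1 (fun y => ln (f y)) (df / f x).
Proof.
by move=> fx0 dfx; have := is_derive1_ln fx0 => h; rewrite mulrC; apply: is_derive1_comp.
Qed.

Lemma is_derive1_continuous f x df :
  is_derive x 1 f df -> {for x, continuous f}.
Proof.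
by move=> [dfx _]; apply: differentiable_continuous; apply/derivable1_diffP.
Qed.

End pointful_derivatives.

(* Dispatch on the syntax of the body: unifying it with the library's pointwise
   operations on function spaces may not terminate. *)
Ltac derive1_step :=
  match goal with
  | |- is_derive _ _ (fun _ => ?c) _ => exact: is_derive1_cstf
  | |- is_derive _ _ (fun y => y) _ => exact: is_derive1_idf
  | |- is_derive _ _ (fun y => @?f y + @?g y) _ => eapply (@is_derive1_Df _ f g)
  | |- is_derive _ _ (fun y => - @?f y) _ => eapply (@is_derive1_Nf _ f)
  | |- is_derive _ _ (fun y => @?f y * @?g y) _ => eapply (@is_derive1_Mf _ f g)
  | |- is_derive _ _ (fun y => @?f y ^+ ?n) _ => eapply (@is_derive1_Xf _ f n)
  | |- is_derive _ _ (fun y => (@?f y)^-1) _ => eapply (@is_derive1_Vf _ f)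
  | |- is_derive _ _ (fun y => expR (@?f y)) _ => eapply (@is_derive1_expRf _ f)
  | |- is_derive _ _ (fun y => ln (@?f y)) _ => eapply (@is_derive1_lnf _ f)
  end.

Ltac derive1_tac := eapply is_derive_eq; [repeat derive1_step | ]; cbn beta.

(** The difference of the two sides vanishes at 1 and has derivative (1 - 1/y)^2 / 2. *)
Lemma ln_le_halfB (R : realType) (x : R) : 1 <= x -> ln x <= (x - x^-1) / 2.
Proof.
move=> x1.
pose df (y : R) := (1 + y ^- 2) / 2 - y^-1.
have : (1 - 1^-1) / 2 - ln 1 <= (x - x^-1) / 2 - ln x.
  apply: (@is_derive_ge0_le R (fun y => (y - y^-1) / 2 - ln y) df) => // y /andP[y1 _].
  - by derive1_tac; rewrite /df ?fctE; [lra|lra|field; lra].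
  - have y0 : 0 < y by lra.
    have -> : df y = (1 - y^-1) ^+ 2 / 2 by rewrite /df; field; lra.
    by rewrite divr_ge0// sqr_ge0.
by rewrite invr1 subrr mul0r ln1 subr0 subr_ge0.
Qed.

(** Both sides change sign under x -> 1/x, so this is [ln_le_halfB] at 1/x. *)
Lemma halfB_le_ln (R : realType) (x : R) : 0 < x <= 1 -> (x - x^-1) / 2 <= ln x.
Proof.
move=> /andP[x0 x1].
have : ln x^-1 <= (x^-1 - x^-1^-1) / 2 by apply: ln_le_halfB; rewrite invf_ge1.
by rewrite lnV ?posrE// invrK; lra.
Qed.

(** The gap has derivative (y - 1)^2 / (y (y + 1)^2). At x = 1 + 1/a this Pade approximant is
    exactly 1 / (a + 1/2). *)
Lemma ln_ge_pade (R : realType) (x : R) : 1 <= x -> 2 * (x - 1) / (x + 1) <= ln x.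
Proof.
move=> x1.
pose df (y : R) := (y - 1) ^+ 2 / (y * (y + 1) ^+ 2).
have : ln 1 - 2 * (1 - 1) / (1 + 1) <= ln x - 2 * (x - 1) / (x + 1).
  apply: (@is_derive_ge0_le R (fun y => ln y - 2 * (y - 1) / (y + 1)) df) => // y /andP[y1 _].
  - by derive1_tac; rewrite /df; [lra|lra|field; lra].
  - by rewrite /df divr_ge0 ?sqr_ge0// mulr_ge0 ?sqr_ge0//; lra.
by rewrite subrr mulr0 mul0r subr0 ln1 subr_ge0.
Qed.

(** The gap has derivative (y - 1)^4 / (6 y^2 (y + 1)^2). The rational function is the one that
    turns, at x = 1 + 1/a, into the telescoping bound of [stirling_step_le]. *)
Lemma ln_le_pade (R : realType) (x : R) : 1 <= x ->
  ln x <= (x - 1) * (x ^+ 2 + 10 * x + 1) / (6 * x * (x + 1)).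
Proof.
move=> x1.
pose F (y : R) := (y - 1) * (y ^+ 2 + 10 * y + 1) / (6 * y * (y + 1)).
pose df (y : R) := (y - 1) ^+ 4 / (6 * y ^+ 2 * (y + 1) ^+ 2).
have : F 1 - ln 1 <= F x - ln x.
  apply: (@is_derive_ge0_le R (fun y => F y - ln y) df 1 x x1) => y /andP[y1 _].
  - rewrite /F; derive1_tac; rewrite /df; last by field; lra.
      by rewrite !mulf_neq0//; lra.
    lra.
  - rewrite /df divr_ge0 ?exprn_even_ge0// !mulr_ge0 ?sqr_ge0//; lra.
by rewrite {1}/F subrr !mul0r ln1 subr0 subr_ge0.
Qed.

(** The derivative is y^2 / (1 + y). Comparison with the value at 0 gives the second-order Taylor
    bound, in opposite directions on the two sides of 0. *)
Lemma ln1D_taylor2_homo (R : realType) (u v : R) : -1 < u -> u <= v ->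
  ln (1 + u) - u + u ^+ 2 / 2 <= ln (1 + v) - v + v ^+ 2 / 2.
Proof.
move=> u1 uv.
pose df (y : R) := y ^+ 2 / (1 + y).
apply: (@is_derive_ge0_le R (fun y => ln (1 + y) - y + y ^+ 2 / 2) df) => // y /andP[uy _].
- by derive1_tac; rewrite /df; [lra|field; lra].
- by rewrite /df divr_ge0 ?sqr_ge0//; lra.
Qed.

Lemma ln1D_ge (R : realType) (u : R) : 0 <= u -> u - u ^+ 2 / 2 <= ln (1 + u).
Proof.
move=> u0; have := @ln1D_taylor2_homo R 0 u _ u0.
rewrite addr0 ln1; have /[swap]/[apply] : (-1 : R) < 0 by lra.
by rewrite expr0n/=; lra.
Qed.

Lemma ln1D_le (R : realType) (u : R) : -1 < u <= 0 -> ln (1 + u) <= u - u ^+ 2 / 2.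
Proof.
move=> /andP[u1 u0]; have := @ln1D_taylor2_homo R u 0 u1 u0.
by rewrite addr0 ln1 expr0n/=; lra.
Qed.

Lemma stirling_step_ge0 (R : realType) (a : R) : 0 < a ->
  0 <= (a + 2^-1) * ln (1 + a^-1) - 1.
Proof.
move=> a0; have : 1 <= 1 + a^-1 by rewrite lerDl invr_ge0 ltW.
move=> /ln_ge_pade h.
have -> : 0 = (a + 2^-1) * (2 * (1 + a^-1 - 1) / (1 + a^-1 + 1)) - 1 :> R.
  by field; lra.
by rewrite lerB// ler_pM2l//; lra.
Qed.

Lemma stirling_step_le (R : realType) (a : R) : 0 < a ->
  (a + 2^-1) * ln (1 + a^-1) - 1 <= (a^-1 - (a + 1)^-1) / 12.
Proof.
move=> a0; have x1 : 1 <= 1 + a^-1 by rewrite lerDl invr_ge0 ltW.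
have h := ln_le_pade x1.
pose x : R := 1 + a^-1.
have -> : (a^-1 - (a + 1)^-1) / 12 =
    (a + 2^-1) * ((x - 1) * (x ^+ 2 + 10 * x + 1) / (6 * x * (x + 1))) - 1 :> R.
  by rewrite /x; field; lra.
by rewrite lerB// ler_pM2l//; lra.
Qed.

(** * Bounds on the logarithms of the standardised kernels *)

Section log_kernel.
Variable R : realType.
Implicit Types s y : R.

(** Logarithm of (1 + y/s)^a e^(-s y), the integrand of r(a), for a = s^2. *)
Definition log_kernel s y := s ^+ 2 * ln (1 + y / s) - s * y.

Let div_gtN1 s y : 0 < s -> - s < y -> -1 < y / s.
Proof. by move=> s0 sy; rewrite ltr_pdivlMr// mulN1r. Qed.

Let halfBE s y : 0 < s -> - s < y ->
  s ^+ 2 * (((1 + y / s) - (1 + y / s)^-1) / 2) - s * y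
  = - (y ^+ 2 / (2 * (1 + y / s))).
Proof. by move=> s0 sy; field; rewrite !gt_eqF//; lra. Qed.

Let taylor2E s y : 0 < s ->
  s ^+ 2 * (y / s - (y / s) ^+ 2 / 2) - s * y = - (y ^+ 2 / 2).
Proof. by move=> s0; field; rewrite gt_eqF. Qed.

(** Follows from [ln1D_ge] and [ln_le_halfB]. Both bounds tend to -y^2/2 as s grows, which gives the
    pointwise limit. *)
Lemma log_kernel_pos s y : 0 < s -> 0 <= y ->
  - (y ^+ 2 / 2) <= log_kernel s y <= - (y ^+ 2 / (2 * (1 + y / s))).
Proof.
move=> s0 y0; have u0 : 0 <= y / s by rewrite divr_ge0// ltW.
apply/andP; split.
  by rewrite -(taylor2E y s0) /log_kernel lerB// ler_pM2l ?exprn_gt0// ln1D_ge.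
rewrite -halfBE//; last lra.
by rewrite /log_kernel lerB// ler_pM2l ?exprn_gt0// ln_le_halfB// lerDl.
Qed.

(** On this side the Gaussian exponent is the upper bound, so it dominates for every s. *)
Lemma log_kernel_neg s y : 0 < s -> - s < y <= 0 ->
  - (y ^+ 2 / (2 * (1 + y / s))) <= log_kernel s y <= - (y ^+ 2 / 2).
Proof.
move=> s0 /andP[sy y0]; have u1 := div_gtN1 s0 sy.
have u0 : y / s <= 0 by rewrite ler_pdivrMr// mul0r.
apply/andP; split.
  rewrite -halfBE//.
  rewrite /log_kernel lerB// ler_pM2l ?exprn_gt0//; apply: halfB_le_ln; lra.
by rewrite -(taylor2E y s0) /log_kernel lerB// ler_pM2l ?exprn_gt0// ln1D_le// u1.
Qed.

(** A bound free of s, for domination on y >= 0: y^2 / (1 + y/s) >= y^2 / (1 + y) >= y - 1. *)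
Lemma log_kernel_le_pos s y : 1 <= s -> 0 <= y -> log_kernel s y <= (1 - y) / 2.
Proof.
move=> s1 y0; have s0 : 0 < s by lra.
have /andP[_ /le_trans->//] := log_kernel_pos s0 y0.
have ys : y / s <= y by rewrite ler_pdivrMr// ler_peMr.
have u0 : 0 <= y / s by rewrite divr_ge0// ltW.
rewrite lerNl -mulNr opprB ler_pdivlMr; last lra.
have [y1|y1] := leP y 1.
  rewrite (@le_trans _ _ 0) ?sqr_ge0//.
  have -> : (y - 1) / 2 * (2 * (1 + y / s)) = - ((1 - y) * (1 + y / s)) by field; lra.
  by rewrite oppr_le0 mulr_ge0//; lra.
have -> : (y - 1) / 2 * (2 * (1 + y / s)) = (y - 1) * (1 + y / s) by field; lra.
rewrite (@le_trans _ _ ((y - 1) * (1 + y)))//; last nra.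
by rewrite ler_wpM2l//; lra.
Qed.

(* Exponent of h(y) h(-y), where h(y) = (1 + y/s)^(s^2-1) e^(-sy); the bound
   is [ln_le_halfB] at 1 / (1 - y^2/s^2). *)
Lemma ln_sym_kernel_ge s y : 1 < s -> 0 <= y <= 1 ->
  - y ^+ 2 + (y ^+ 2 - y ^+ 4 / 2) / s ^+ 2 <= (s ^+ 2 - 1) * ln (1 - y ^+ 2 / s ^+ 2).
Proof.
move=> s1 /andP[y0 y1].
have s2 : 1 < s ^+ 2 by rewrite exprn_egt1.
have y2 : y ^+ 2 <= 1 by rewrite expr_le1.
set w := y ^+ 2 in y2 *.
have w0 : 0 <= w by rewrite sqr_ge0.
have -> : y ^+ 4 = w ^+ 2 by rewrite /w -exprM.
set S := s ^+ 2 in s2 *.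
have v1 : w / S < 1 by rewrite ltr_pdivrMr ?mul1r; lra.
have v0 : 0 <= w / S by rewrite divr_ge0//; lra.
have := @halfB_le_ln R (1 - w / S) _.
have /[swap]/[apply] h : 0 < 1 - w / S <= 1 by lra.
have {}h : (S - 1) * ((1 - w / S - (1 - w / S)^-1) / 2) <= (S - 1) * ln (1 - w / S).
  by rewrite ler_pM2l//; lra.
apply: le_trans h.
have Sw : 0 < S - w by lra.
have S0 : 0 < S by lra.
rewrite -subr_ge0.
have -> : (S - 1) * ((1 - w / S - (1 - w / S)^-1) / 2) - (- w + (w - w ^+ 2 / 2) / S)
   = w ^+ 2 * (1 - w) / (2 * S * (S - w)).
  by field; rewrite !gt_eqF.
by apply: divr_ge0; rewrite !mulr_ge0 ?sqr_ge0//; lra.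
Qed.

(** Serves only the limit s -> +oo, so the error 2/s, uniform in y, may be crude. The logarithm is
    bounded by [ln_le_halfB] for y >= 0 and by [ln1D_le] for y <= 0. *)
Lemma kernel_exponent_le s y : 1 < s -> -1 <= y <= 1 ->
  (s ^+ 2 - 1) * ln (1 + y / s) - s * y <= - (y ^+ 2 / 2) + 2 / s.
Proof.
move=> s1 /andP[y1 y1'].
have s0 : 0 < s by lra.
have s2 : 1 < s ^+ 2 by rewrite exprn_egt1.
have r0 : 0 < s^-1 by rewrite invr_gt0.
have r1 : s^-1 < 1 by rewrite invf_lt1.
have ysE : y / s = y * s^-1 by [].
have y2 : y ^+ 2 <= 1 by rewrite -[y ^+ 2]ger0_norm ?sqr_ge0// normrX expr_le1// ler_norml y1.
have y20 := sqr_ge0 y.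
have [yge0|/ltW yle0] := leP 0 y.
  have u0 : 0 <= y / s by rewrite divr_ge0// ltW.
  have := @ln_le_halfB R (1 + y / s) _.
  have /[swap]/[apply] h : 1 <= 1 + y / s by lra.
  apply: (@le_trans _ _ ((s ^+ 2 - 1) * ((1 + y / s - (1 + y / s)^-1) / 2) - s * y)).
    by rewrite lerB// ler_pM2l//; lra.
  have -> : (s ^+ 2 - 1) * ((1 + y / s - (1 + y / s)^-1) / 2) - s * y =
     - (y ^+ 2 / 2) + 2 / s - ((2 + y) / s - (1 + s * y) * y ^+ 2 / (2 * s * (s + y))).
    by field; rewrite !gt_eqF//; lra.
  rewrite gerBl subr_ge0 ler_pdivrMr; last by rewrite !mulr_gt0//; lra.
  have -> : (2 + y) / s * (2 * s * (s + y)) = 2 * (2 + y) * (s + y).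
    by field; rewrite gt_eqF.
  have sy0 : 0 <= s * y by rewrite mulr_ge0// ltW.
  apply: (@le_trans _ _ (1 + s * y)); first by rewrite ler_piMr//; lra.
  have -> : 2 * (2 + y) * (s + y) = 4 * s + 4 * y + 2 * (s * y) + 2 * y ^+ 2 by ring.
  lra.
have u1 : -1 < y / s by rewrite ltr_pdivlMr// mulN1r; lra.
have u0 : y / s <= 0 by rewrite ler_pdivrMr// mul0r.
have := @ln1D_le R (y / s) _.
have /[swap]/[apply] h : -1 < y / s <= 0 by rewrite u1.
apply: (@le_trans _ _ ((s ^+ 2 - 1) * (y / s - (y / s) ^+ 2 / 2) - s * y)).
  by rewrite lerB// ler_pM2l//; lra.
have -> : (s ^+ 2 - 1) * (y / s - (y / s) ^+ 2 / 2) - s * y =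
   - (y ^+ 2 / 2) + (- y * s^-1 + y ^+ 2 * s^-1 ^+ 2 / 2).
  by field; rewrite gt_eqF.
rewrite lerD2l; nra.
Qed.

End log_kernel.

(** * The Gamma integral and its normalisation *)

Section gamma_integral.
Variable R : realType.
Notation mu := (@lebesgue_measure R).
Implicit Types a b x : R.

Definition gamma_integrand a b x : R := x `^ (a - 1) * expR (- (x / b)).

(** Kept in the extended reals, so that the recurrence can be proved before the integral is known to
    be finite. *)
Definition gamma_integral a b : \bar R :=
  (\int[mu]_(x in `]0%R, +oo[) (gamma_integrand a b x)%:E)%E.

Lemma gamma_funE a : gamma_fun a = fine (gamma_integral a 1).
Proof.
rewrite /gamma_fun /gamma_integral /Rintegral; congr fine.
by apply: eq_integral => x _; rewrite /gamma_integrand divr1.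
Qed.

Lemma gamma_integrand_ge0 a b x : 0 <= gamma_integrand a b x.
Proof. by rewrite mulr_ge0 ?powR_ge0 ?expR_ge0. Qed.

Lemma measurable_gamma_integrand a b : measurable_fun setT (gamma_integrand a b).
Proof.
apply: measurable_funM; first exact: measurable_powR.
apply: measurableT_comp => //; apply: measurableT_comp => //.
exact: measurable_funM.
Qed.

Lemma gamma_integrandD1 a b :
  gamma_integrand (a + 1) b = fun x => x `^ a * expR (- (x / b)).
Proof. by apply/funext => x; rewrite /gamma_integrand addrK. Qed.

Lemma is_derive_gamma_integrand a b x : 0 < x ->
  is_derive x 1 (gamma_integrand (a + 1) b)
    (a * gamma_integrand a b x - gamma_integrand (a + 1) b x / b).
Proof.
move=> x0; rewrite gamma_integrandD1 /gamma_integrand.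
eapply is_derive_eq.
  eapply (@is_derive1_Mf _ (@powR R ^~ a)); first exact: is_derive1_powR.
  by repeat derive1_step.
cbn beta; ring.
Qed.

Lemma continuous_gamma_integrand a b x : 0 < x ->
  {for x, continuous (gamma_integrand a b)}.
Proof.
move=> x0; have := @is_derive_gamma_integrand (a - 1) b x x0.
by rewrite subrK; exact: is_derive1_continuous.
Qed.

Lemma within_continuous_gamma_integrand a b p q : 0 < p ->
  {within `[p, q], continuous (gamma_integrand a b)}.
Proof.
move=> p0; apply: continuous_in_subspaceT => x.
by rewrite inE/= in_itv/= => /andP[px _]; apply: continuous_gamma_integrand => //; lra.
Qed.

(** Half of the exponential decay absorbs the power: ln u <= u - 1 at u = x / (2 a b). *)
Lemma gamma_integrand_le a b x : 0 < a -> 0 < b -> 0 < x ->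
  gamma_integrand (a + 1) b x <= (2 * a * b) `^ a * expR (- (x / (2 * b))).
Proof.
move=> a0 b0 x0; rewrite /gamma_integrand addrK.
have ab0 : 0 < 2 * a * b by rewrite !mulr_gt0.
rewrite /powR !gt_eqF// -!expRD ler_expR.
have := @le_ln1Dx R (x / (2 * a * b) - 1) _.
have xab0 : 0 < x / (2 * a * b) by rewrite divr_gt0.
have /[swap]/[apply] : -1 < x / (2 * a * b) - 1 by lra.
rewrite addrC subrK ln_div ?posrE// => h.
have {}h : a * (ln x - ln (2 * a * b)) <= a * (x / (2 * a * b) - 1) by rewrite ler_pM2l.
have E : a * (x / (2 * a * b) - 1) = x / (2 * b) - a by field; rewrite !gt_eqF.
have E' : x / b = 2 * (x / (2 * b)) by field; rewrite gt_eqF.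
rewrite E'; rewrite E in h; lra.
Qed.

Lemma gamma_integrand_cvgy a b : 0 < a -> 0 < b ->
  gamma_integrand (a + 1) b n.+2%:R @[n --> \oo] --> (0 : R).
Proof.
move=> a0 b0.
have c0 : 0 < (2 * b)^-1 by rewrite invr_gt0 mulr_gt0.
apply: (@squeeze_cvgr _ _ _ _ (fun=> 0)
  (fun n : nat => (2 * a * b) `^ a * expR (- (n.+2%:R / (2 * b))))).
- near=> n; rewrite gamma_integrand_ge0/=.
  exact: gamma_integrand_le.
- exact: cvg_cst.
- rewrite -[X in _ --> X](mulr0 ((2 * a * b) `^ a)); apply: cvgMr.
  apply: (@cvg_comp _ _ _ (fun n : nat => n.+2%:R / (2 * b)) (fun x => expR (- x)) _ +oo%R);
    last exact: cvgr_expR.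
  apply/cvgryPge => A; near=> n.
  rewrite ler_pdivlMr ?mulr_gt0//.
  rewrite (@le_trans _ _ n%:R)//; last by rewrite ler_nat -addn2 leq_addr.
  by near: n; exact: nbhs_infty_ger.
Unshelve. all: end_near. Qed.

Lemma gamma_integrand_cvg0 a b : 0 < a -> 0 < b ->
  gamma_integrand (a + 1) b n.+2%:R^-1 @[n --> \oo] --> (0 : R).
Proof.
move=> a0 b0.
apply: (@squeeze_cvgr _ _ _ _ (fun=> 0) (fun n : nat => (n.+2%:R^-1 : R) `^ a)).
- near=> n; rewrite gamma_integrand_ge0/= gamma_integrandD1 ler_piMr ?powR_ge0//.
  by rewrite expR_le1 oppr_le0 divr_ge0// ltW.
- exact: cvg_cst.
- apply: (@cvg_comp _ _ _ (fun n : nat => n.+2%:R^-1 : R) (fun x => x `^ a) _ 0^'+).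
    have : (n.+2%:R^-1 : R) @[n --> \oo] --> (0 : R).
      by have := @cvg_harmonic R; rewrite -cvg_shiftS.
    move=> h P P0; apply: (@filterS nat \oo _ _ _ _ (h _ P0)) => n /=.
    by apply; rewrite invr_gt0.
  exact: powR_cvg0.
Unshelve. all: end_near. Qed.

(** The offset 2 gives 1/(n+2) < 1 < n+2, so that no interval degenerates to a point. *)
Lemma itv0y_bigcup :
  `]0%R, +oo[%classic = \bigcup_n `[n.+2%:R^-1, n.+2%:R]%classic :> set R.
Proof.
apply/seteqP; split => x /=; last first.
  move=> [n _]; rewrite /= !in_itv/= andbT => /andP[+ _].
  by apply: lt_le_trans; rewrite invr_gt0.
rewrite in_itv/= andbT => x0.
have [n] : exists n : nat, x <= n.+2%:R /\ x^-1 <= n.+2%:R.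
  pose m := Num.bound (Num.max x x^-1).
  have m0 : 0 <= Num.max x x^-1 by rewrite le_max ltW.
  have := archi_boundP m0; rewrite -/m gt_max => /andP[/ltW h1 /ltW h2].
  by exists m; split; [apply: (le_trans h1)|apply: (le_trans h2)]; rewrite ler_nat leqW.
move=> [h1 h2]; exists n => //=.
by rewrite in_itv/= h1 andbT invf_ple ?posrE.
Qed.

Lemma cvg_gamma_integral a b :
  (\int[mu]_(x in `[(n.+2%:R^-1)%R, n.+2%:R]) (gamma_integrand a b x)%:E)%E
    @[n --> \oo] --> gamma_integral a b.
Proof.
rewrite /gamma_integral itv0y_bigcup.
apply: ge0_nondecreasing_set_cvg_integral => //.
- apply/nondecreasing_seqP => n; apply/subsetPset => x /=.
  rewrite !in_itv/= => /andP[h1 h2]; apply/andP; split.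
    by apply: le_trans h1; rewrite lef_pV2 ?posrE// ler_nat.
  by apply: (le_trans h2); rewrite ler_nat.
- move=> n; apply/measurable_EFinP/measurable_funTS.
  exact: measurable_gamma_integrand.
- by move=> n x _; rewrite lee_fin gamma_integrand_ge0.
Qed.

(** Integration by parts: integrate the derivative of x^a e^(-x/b). The sign of a is free; the tail
    bound for small shapes uses exponent a - 1 <= 0. *)
Lemma integral_gamma_integrand_itv a b p q : 0 < p -> p < q ->
  (a%:E * \int[mu]_(x in `[p, q]) (gamma_integrand a b x)%:E =
   b^-1%:E * \int[mu]_(x in `[p, q]) (gamma_integrand (a + 1) b x)%:E
   + (gamma_integrand (a + 1) b q - gamma_integrand (a + 1) b p)%:E)%E.
Proof.
move=> p0 pq.
have int c : mu.-integrable `[p, q] (EFin \o gamma_integrand c b).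
  apply: continuous_compact_integrable; first exact: segment_compact.
  exact: within_continuous_gamma_integrand.
have := @continuous_FTC2 R
  (fun x => a * gamma_integrand a b x - b^-1 * gamma_integrand (a + 1) b x)
  (gamma_integrand (a + 1) b) p q pq.
have E1 : {within `[p, q], continuous
    (fun x => a * gamma_integrand a b x - b^-1 * gamma_integrand (a + 1) b x)}.
  apply: continuous_in_subspaceT => x; rewrite inE/= in_itv/= => /andP[px _].
  have x0 := lt_le_trans p0 px.
  by apply: (@cvgB _ R^o); apply: cvgMr; exact: continuous_gamma_integrand.
have E2 : derivable_oo_LRcontinuous (gamma_integrand (a + 1) b) p q.
  split.
  - move=> x; rewrite in_itv/= => /andP[px _].
    by have [] := @is_derive_gamma_integrand a b x (lt_trans p0 px).
  - by apply: cvg_at_right_filter; exact: continuous_gamma_integrand.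
  - by apply: cvg_at_left_filter; apply: continuous_gamma_integrand; exact: lt_trans pq.
have E3 : {in `]p, q[, derive1 (gamma_integrand (a + 1) b) =1
    (fun x => a * gamma_integrand a b x - b^-1 * gamma_integrand (a + 1) b x)}.
  move=> x; rewrite in_itv/= => /andP[px _].
  have := @is_derive_gamma_integrand a b x (lt_trans p0 px).
  by move=> d; rewrite derive1E derive_val [_ / b]mulrC.
move=> /(_ E1 E2 E3).
under eq_integral do rewrite EFinB 2!EFinM.
have intZ c e : mu.-integrable `[p, q] (fun x => e%:E * (gamma_integrand c b x)%:E)%E.
  by apply: integrableZl => //; exact: int.
rewrite integralB//; [|exact: intZ|exact: intZ].
rewrite (integralZl _ (int a))// (integralZl _ (int (a + 1)))//.
rewrite -EFinB => <-.
rewrite addeCA subee ?adde0//.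
by rewrite fin_numM//; apply: integrable_fin_num => //; exact: int.
Qed.

(** Let the ends in [integral_gamma_integrand_itv] tend to 0 and +oo; both boundary values
    vanish. *)
Lemma gamma_integralD1 a b : 0 < a -> 0 < b ->
  gamma_integral (a + 1) b = ((a * b)%:E * gamma_integral a b)%E.
Proof.
move=> a0 b0.
have h1 : (a%:E * \int[mu]_(x in `[(n.+2%:R^-1)%R, n.+2%:R]) (gamma_integrand a b x)%:E)%E
    @[n --> \oo] --> (a%:E * gamma_integral a b)%E.
  by apply: cvgeZl => //; exact: cvg_gamma_integral.
have h2 : (b^-1%:E * \int[mu]_(x in `[(n.+2%:R^-1)%R, n.+2%:R]) (gamma_integrand (a + 1) b x)%:E
   + (gamma_integrand (a + 1) b n.+2%:R - gamma_integrand (a + 1) b n.+2%:R^-1)%:E)%E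
    @[n --> \oo] --> (b^-1%:E * gamma_integral (a + 1) b + 0%:E)%E.
  apply: cvgeD; first by rewrite fin_num_adde_defl.
    by apply: cvgeZl => //; exact: cvg_gamma_integral.
  apply: cvg_EFin; first exact: nearW.
  rewrite -[X in _ --> X](subr0 0).
  by apply: cvgB; [exact: gamma_integrand_cvgy|exact: gamma_integrand_cvg0].
have E : (a%:E * gamma_integral a b = b^-1%:E * gamma_integral (a + 1) b + 0%:E)%E.
  apply: (cvg_unique _ h1); first exact: ereal_hausdorff.
  apply: cvg_trans h2; apply: near_eq_cvg; near=> n.
  rewrite (@integral_gamma_integrand_itv a b n.+2%:R^-1 n.+2%:R) ?invr_gt0//.
  by rewrite (@lt_trans _ _ 1)// ?invf_lt1// ltr1n.
by rewrite mulrC EFinM -muleA E adde0 muleA -EFinM divff ?mul1e// gt_eqF.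
Unshelve. all: end_near. Qed.

End gamma_integral.

(** * Laplace's method for the Gamma integral *)

Section laplace.
Variable R : realType.
Notation mu := (@lebesgue_measure R).
Implicit Types (s y : R).

Lemma normal_pdf01E y : normal_pdf 0 1 y = normal_peak 1 * expR (- (y ^+ 2 / 2)).
Proof.
rewrite normal_pdfE ?oner_neq0//; congr (_ * expR _).
by rewrite subr0 expr1n mulr2n mulNr.
Qed.

Lemma integral_expR_halfsqr :
  (\int[mu]_y (expR (- (y ^+ 2 / 2)))%:E = (normal_peak 1)^-1%:E)%E.
Proof.
have k0 : 0 < normal_peak (1 : R) by rewrite normal_peak_gt0// oner_neq0.
have mE : measurable_fun setT (fun y : R => expR (- (y ^+ 2 / 2))).
  apply: measurableT_comp => //; apply: measurableT_comp => //.
  exact: measurable_funM.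
have := @integral_normal_pdf R 0 1.
under eq_integral do rewrite normal_pdf01E EFinM.
rewrite ge0_integralZl//=; last 2 first.
- exact/measurable_EFinP.
- by rewrite lee_fin ltW.
move=> h; rewrite -[LHS]mul1e -[X in (X%:E * _)%E](mulVf (lt0r_neq0 k0)) EFinM -muleA h.
by rewrite mule1.
Qed.

Lemma measurable_expR_log_kernel s (D : set R) :
  measurable_fun D (fun y => expR (log_kernel s y)).
Proof.
apply: measurable_funTS; apply: measurableT_comp => //.
apply: measurable_funB; last exact: measurable_funM.
apply: measurable_funM => //; apply: measurableT_comp; first exact: measurable_ln.
by apply: measurable_funD => //; exact: measurable_funM.
Qed.

(** Substitution x = s^2 + s y; the factor is the maximum of x^(s^2) e^(-x), reached at x = s^2,
    times the Jacobian s. *)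
Lemma gamma_integral_kernel s : 0 < s ->
  (gamma_integral (s ^+ 2 + 1) 1 =
   (expR (s ^+ 2 * ln (s ^+ 2) - s ^+ 2) * s)%:E *
   \int[mu]_(y in `](- s)%R, +oo[) (expR (log_kernel s y))%:E)%E.
Proof.
move=> s0; pose F y : R := s ^+ 2 + s * y.
have S0 : 0 < s ^+ 2 by rewrite exprn_gt0.
have dF y : is_derive y 1 F s.
  by rewrite /F; derive1_tac; ring.
have F'E : derive1 F = cst s.
  by apply/funext => y; rewrite derive1E; have [_ ->] := dF y.
have cF : continuous F.
  by move=> y; exact: is_derive1_continuous (dF y).
have F0 : F (- s) = 0 by rewrite /F; ring.
rewrite /gamma_integral integral_itv_obnd_cbnd; last first.
  by apply/measurable_EFinP/measurable_funTS; exact: measurable_gamma_integrand.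
rewrite -[X in `[X, +oo[]F0 increasing_ge0_integration_by_substitutiony; first last.
- by move=> x _; exact: gamma_integrand_ge0.
- rewrite F0; apply/continuous_within_itvcyP; split.
    move=> x; rewrite in_itv/= andbT => x0.
    exact: continuous_gamma_integrand.
  (* Right continuity at the added endpoint 0: the power has exponent s^2 > 0, so its value there is
     0 and agrees with its limit. *)
  rewrite gamma_integrandD1 powR0 ?gt_eqF// ?mul0r.
  rewrite -[X in _ --> X](mul0r (expR (- (0 / 1)))).
  apply: cvgM; first exact: powR_cvg0.
  apply: cvg_at_right_filter; apply: continuous_comp; last exact: continuous_expR.
  apply: continuousN; apply: continuousM; [exact: cvg_id|exact: cvg_cst].
- apply: (@cvg_comp _ _ _ ( *%R s) (fun y => s ^+ 2 + y) _ +oo%R).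
    by apply: gt0_cvgMry => //; exact: cvg_id.
  exact: cvg_addrl.
- split; first by move=> y _; have [] := dF y.
  by apply: cvg_at_right_filter; exact: cF.
- by rewrite F'E; exact: is_cvg_cst.
- by rewrite F'E; exact: is_cvg_cst.
- by rewrite F'E => y _; exact: cvg_cst.
- by move=> x y _ _ xy; rewrite /F ltrD2l ltr_pM2l.
rewrite F'E.
have mG : measurable_fun setT ((gamma_integrand (s ^+ 2 + 1) 1 \o F) * cst s).
  apply: measurable_funM => //; apply: measurableT_comp.
    exact: measurable_gamma_integrand.
  by apply: continuous_measurable_fun.
rewrite -integral_itv_obnd_cbnd; last exact/measurable_EFinP/measurable_funTS.
rewrite -ge0_integralZl//=; last 2 first.
- by apply/measurable_EFinP; exact: measurable_expR_log_kernel.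
- by rewrite lee_fin mulr_ge0 ?expR_ge0// ltW.
apply: eq_integral => y; rewrite inE/= in_itv/= andbT => sy.
rewrite -EFinM; congr EFin.
have u0 : 0 < 1 + y / s by rewrite -ltrBlDl sub0r ltr_pdivlMr// mulN1r.
have FE : F y = s ^+ 2 * (1 + y / s) by rewrite /F; field; rewrite gt_eqF.
rewrite fctE/= gamma_integrandD1 /powR gt_eqF; last by rewrite FE mulr_gt0.
rewrite divr1 [in LHS]mulrC [in RHS]mulrAC mulrC; congr (_ * _).
rewrite -!expRD; congr expR.
by rewrite FE lnM ?posrE// /log_kernel; field; rewrite gt_eqF.
Qed.

(** Gaussian for y <= 0, e^((1 - y)/2) for y >= 0. The latter is written as a multiple of the
    exponential density of rate 1/2, whose integrability is known. *)
Let dom y : R := expR (- (y ^+ 2 / 2)) + 2 * expR 2^-1 * exponential_pdf 2^-1 y.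

Lemma integrable_dom : mu.-integrable setT (EFin \o dom).
Proof.
have k0 : 0 < normal_peak (1 : R) by rewrite normal_peak_gt0// oner_neq0.
rewrite (_ : EFin \o dom = (fun y => ((normal_peak 1)^-1%:E * (normal_pdf 0 1 y)%:E) +
   (2 * expR 2^-1)%:E * (exponential_pdf 2^-1 y)%:E)%E).
  apply: integrableD => //; apply: integrableZl => //.
    exact: integrable_normal_pdf.
  by apply: integrable_exponential_pdf; rewrite invr_gt0.
apply/funext => y; rewrite /= -!EFinM -EFinD normal_pdf01E /dom mulrA mulVf ?mul1r//.
by rewrite gt_eqF.
Qed.

Lemma expR_log_kernel_le_dom s y : 1 <= s -> - s < y -> expR (log_kernel s y) <= dom y.
Proof.
move=> s1 sy; rewrite /dom.
have [y0|/ltW y0] := leP 0 y.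
  apply: (@le_trans _ _ (2 * expR 2^-1 * exponential_pdf 2^-1 y)); last first.
    by rewrite lerDr expR_ge0.
  rewrite exponential_pdfE//.
  have -> : 2 * expR 2^-1 * (2^-1 * expR (- 2^-1 * y)) = expR ((1 - y) / 2) :> R.
    have -> : (1 - y) / 2 = 2^-1 + - 2^-1 * y by field.
    by rewrite expRD; field.
  by rewrite ler_expR log_kernel_le_pos.
apply: (@le_trans _ _ (expR (- (y ^+ 2 / 2)))).
  rewrite ler_expR; have s0 : 0 < s by lra.
  by have /andP[] := @log_kernel_neg R s y s0 (introT andP (conj sy y0)).
by rewrite lerDl !mulr_ge0 ?expR_ge0 ?exponential_pdf_ge0 ?invr_ge0.
Qed.

Lemma log_kernel_cvg (s : nat -> R) y : (forall n, 0 < s n) -> s @ \oo --> +oo ->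
  log_kernel (s n) y @[n --> \oo] --> - (y ^+ 2 / 2).
Proof.
move=> s0 soo.
have sV : (s n)^-1 @[n --> \oo] --> (0 : R).
  by apply/gtr0_cvgV0 => //; exact: nearW.
have h : - (y ^+ 2 / (2 * (1 + y / s n))) @[n --> \oo] --> - (y ^+ 2 / 2).
  apply: cvgN; apply: cvgMr.
  have E : 2^-1 = (2 * (1 + y * 0))^-1 :> R by rewrite mulr0 addr0 mulr1.
  rewrite [X in _ --> X]E; apply: cvgV; first by rewrite mulr0 addr0 mulr1.
  by apply: cvgMr; apply: cvgD; [exact: cvg_cst|exact: cvgMr].
have [y0|/ltW y0] := leP 0 y.
  apply: (squeeze_cvgr _ (cvg_cst _) h).
  by apply: nearW => n; exact: log_kernel_pos.
apply: (squeeze_cvgr _ h (cvg_cst _)).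
near=> n; apply: log_kernel_neg => //; rewrite y0 andbT ltrNl.
by near: n; move/cvgryPgt : soo; apply.
Unshelve. all: end_near. Qed.

Lemma expR_log_kernel_cvg (s : nat -> R) y : (forall n, 0 < s n) -> s @ \oo --> +oo ->
  expR (log_kernel (s n) y) @[n --> \oo] --> expR (- (y ^+ 2 / 2)).
Proof.
move=> s0 soo.
apply: (@cvg_comp _ _ _ (fun n => log_kernel (s n) y) expR).
  exact: log_kernel_cvg.
exact: continuous_expR.
Qed.

Lemma cvg_integral_kernel (s : nat -> R) : (forall n, 1 <= s n) -> s @ \oo --> +oo ->
  (\int[mu]_(y in `](- s n)%R, +oo[) (expR (log_kernel (s n) y))%:E)%E
    @[n --> \oo] --> ((normal_peak 1)^-1%:E : \bar R).
Proof.
move=> s1 soo; have s0 n : 0 < s n by exact: lt_le_trans (s1 n).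
rewrite -integral_expR_halfsqr.
(* The domain varies with n, so the integrands are extended by 0 to the whole line. *)
under eq_fun do rewrite integral_mkcond.
have [] // := @dominated_convergence _ _ R mu setT measurableT
  (fun n => (fun y => (expR (log_kernel (s n) y))%:E) \_ `](- s n)%R, +oo[)
  (fun y => (expR (- (y ^+ 2 / 2)))%:E) (EFin \o dom).
- move=> n; apply/(measurable_restrictT (fun y => (expR (log_kernel (s n) y))%:E)) => //.
  by apply/measurable_EFinP; exact: measurable_expR_log_kernel.
- apply/measurable_EFinP; apply: measurableT_comp => //; apply: measurableT_comp => //.
  exact: measurable_funM.
- apply: aeW => y _ /=.
  have h : (expR (log_kernel (s n) y))%:E @[n --> \oo] --> (expR (- (y ^+ 2 / 2)))%:E.
    apply: cvg_EFin; first exact: nearW.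
    exact: expR_log_kernel_cvg.
  apply: cvg_trans h; apply: near_eq_cvg; near=> n.
  rewrite patchE ifT// inE/= in_itv/= andbT ltrNl.
  by near: n; move/cvgryPgt : soo; apply.
- exact: integrable_dom.
- apply: aeW => y n _; rewrite patchE; case: ifPn => [|_].
    rewrite inE/= in_itv/= andbT => sy.
    by rewrite lee_fin ger0_norm ?expR_ge0// expR_log_kernel_le_dom.
  (* The restriction takes the default value [point] outside its domain; in the extended reals this
     is 0. *)
  rewrite [point](_ : _ = 0%E)// abse0 lee_fin addr_ge0 ?expR_ge0//.
  by rewrite !mulr_ge0 ?expR_ge0 ?exponential_pdf_ge0 ?invr_ge0.
Unshelve. all: end_near. Qed.

End laplace.

(** * Two-sided Stirling bounds *)

Section stirling.
Variable R : realType.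
Notation mu := (@lebesgue_measure R).
Implicit Types a : R.

(** Holds for infinite X too, where both sides are 0; the recurrence thus passes to [gamma_fun]
    without a convergence proof. *)
Lemma fine_pmulel (c : R) (X : \bar R) : 0 < c -> fine (c%:E * X)%E = c * fine X.
Proof.
move=> c0; case: X => [x| |] //=; rewrite mulr0.
- by rewrite gt0_muley ?lte_fin.
- by rewrite gt0_muleNy ?lte_fin.
Qed.

Lemma gamma_fun_ge0 a : 0 <= gamma_fun a.
Proof.
by apply: Rintegral_ge0 => x _; rewrite mulr_ge0 ?powR_ge0 ?expR_ge0.
Qed.

Lemma gamma_funD1 a : 0 < a -> gamma_fun (a + 1) = a * gamma_fun a.
Proof.
by move=> a0; rewrite !gamma_funE gamma_integralD1// mulr1 fine_pmulel.
Qed.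

(** The r(a) of the overview, with a^(a+1/2) e^(-a) written as a single exponential. *)
Definition stirling_ratio a := gamma_fun (a + 1) / expR ((a + 2^-1) * ln a - a).

Lemma stirling_ratio_ge0 a : 0 <= stirling_ratio a.
Proof. by rewrite divr_ge0 ?gamma_fun_ge0 ?expR_ge0. Qed.

Lemma stirling_ratioE a : 0 < a -> stirling_ratio a =
  fine (\int[mu]_(y in `](- Num.sqrt a)%R, +oo[) (expR (log_kernel (Num.sqrt a) y))%:E)%E.
Proof.
move=> a0; have s0 : 0 < Num.sqrt a by rewrite sqrtr_gt0.
have aE : a = Num.sqrt a ^+ 2 by rewrite sqr_sqrtr// ltW.
rewrite /stirling_ratio gamma_funE {1}aE gamma_integral_kernel// fine_pmulel; last first.
  by rewrite mulr_gt0// expR_gt0.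
rewrite -aE mulrC mulrA.
have -> : Num.sqrt a = expR (2^-1 * ln a) by rewrite -powR12_sqrt ?ltW// /powR gt_eqF.
rewrite -[in X in X * _]expRD -expRN -expRD.
by rewrite (_ : _ + _ = 0) ?expR0 ?mul1r//; ring.
Qed.

Lemma stirling_ratio_cvg a : 0 < a ->
  stirling_ratio (a + n%:R) @[n --> \oo] --> (normal_peak (1 : R))^-1.
Proof.
(* After the shift, sqrt (a + n + 1) >= 1, as the domination requires. *)
move=> a0; rewrite -cvg_shiftS.
pose s (n : nat) := Num.sqrt (a + n.+1%:R).
have s1 n : 1 <= s n.
  rewrite /s -[leLHS]sqrtr1 ler_wsqrtr// -[leLHS]add0r lerD ?ler1n// ltW//.
have soo : s @ \oo --> +oo.
  apply/cvgryPge => A; near=> k.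
  apply: (le_trans (ler_norm A)); rewrite -sqrtr_sqr ler_wsqrtr//.
  apply: (@le_trans _ _ k.+1%:R); last by rewrite lerDr ltW.
  apply: (@le_trans _ _ k%:R); last by rewrite ler_nat.
  by near: k; exact: nbhs_infty_ger.
have h := fine_cvg (cvg_integral_kernel s1 soo).
rewrite (_ : [sequence _]_n = fine \o (fun n : nat =>
  (\int[mu]_(y in `](- s n)%R, +oo[) (expR (log_kernel (s n) y))%:E)%E)); first exact: h.
by apply/funext => n; rewrite /= stirling_ratioE// addr_gt0.
Unshelve. all: end_near. Qed.

Lemma stirling_ratioD1 a : 0 < a ->
  stirling_ratio (a + 1) = stirling_ratio a * expR (- ((a + 2^-1) * ln (1 + a^-1) - 1)).
Proof.
move=> a0; have a10 : 0 < a + 1 by lra.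
rewrite /stirling_ratio gamma_funD1//.
have -> : ln (a + 1) = ln a + ln (1 + a^-1).
  rewrite -lnM ?posrE// ?addr_gt0 ?invr_gt0//.
  by rewrite mulrDr mulr1 divff// gt_eqF.
have E : a + 1 = expR (ln a + ln (1 + a^-1)).
  rewrite expRD !lnK ?posrE ?addr_gt0 ?invr_gt0//.
  by rewrite mulrDr mulr1 divff// gt_eqF.
rewrite {1}E -!expRN mulrAC -[RHS]mulrA -expRD mulrC; congr (_ * _).
by rewrite -expRD; congr expR; field.
Qed.

(** By [stirling_step_ge0], r(a + n) decreases in n to its limit 1/k. *)
Lemma stirling_ratio_ge a : 0 < a -> (normal_peak (1 : R))^-1 <= stirling_ratio a.
Proof.
move=> a0; pose u (n : nat) := stirling_ratio (a + n%:R).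
have u_cvg := stirling_ratio_cvg a0.
have -> : stirling_ratio a = u 0%N by rewrite /u addr0.
rewrite -(cvg_lim _ u_cvg)//; apply: nonincreasing_cvgn_ge;
  last by apply/cvg_ex; eexists; exact: u_cvg.
apply/nonincreasing_seqP => n; rewrite /u -natr1 addrA.
have an0 : 0 < a + n%:R by rewrite ltr_wpDr.
by rewrite stirling_ratioD1// ler_piMr ?stirling_ratio_ge0// expR_le1 oppr_le0 stirling_step_ge0.
Qed.

(** Since the bound of [stirling_step_le] telescopes, r(a + n) e^(-1/(12 (a + n))) increases in n to
    1/k. *)
Lemma stirling_ratio_le a : 0 < a ->
  stirling_ratio a <= (normal_peak (1 : R))^-1 * expR (12 * a)^-1.
Proof.
move=> a0; pose v (n : nat) := stirling_ratio (a + n%:R) * expR (- (12 * (a + n%:R))^-1).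
have an0 n : 0 < a + n%:R by rewrite ltr_wpDr.
have v_cvg : v @ \oo --> (normal_peak (1 : R))^-1.
  rewrite -[X in _ --> X]mulr1 -[X in _ * X]expR0.
  apply: cvgM; first exact: stirling_ratio_cvg.
  apply: (@cvg_comp _ _ _ (fun n : nat => - (12 * (a + n%:R))^-1) expR _ (nbhs (0 : R)));
    last exact: continuous_expR.
  change (- (12 * (a + n%:R))^-1 @[n --> \oo] --> (0 : R)).
  rewrite -[X in _ --> X]oppr0; apply: cvgN; apply/gtr0_cvgV0.
    by apply: nearW => n; rewrite mulr_gt0.
  apply/cvgryPge => A; near=> k.
  apply: (@le_trans _ _ (a + k%:R)); last by rewrite ler_peMl ?ler1n// ltW.
  apply: (@le_trans _ _ k%:R); last by rewrite lerDr ltW.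
  by near: k; exact: nbhs_infty_ger.
rewrite -ler_pdivrMr ?expR_gt0// -expRN.
have -> : stirling_ratio a * expR (- (12 * a)^-1) = v 0%N by rewrite /v addr0.
rewrite -(cvg_lim _ v_cvg)//; apply: nondecreasing_cvgn_le;
  last by apply/cvg_ex; eexists; exact: v_cvg.
apply/nondecreasing_seqP => n; rewrite /v -[n.+1%:R]natr1 addrA.
rewrite stirling_ratioD1// -[leRHS]mulrA -expRD ler_wpM2l ?stirling_ratio_ge0// ler_expR.
have := stirling_step_le (an0 n).
set b := a + n%:R.
have -> : (b^-1 - (b + 1)^-1) / 12 = (12 * b)^-1 - (12 * (b + 1))^-1 by rewrite !invfM; ring.
lra.
Unshelve. all: end_near. Qed.

(** The value 0 would contradict r(a) >= 1/k > 0. As [fine] sends +oo to 0, this also excludes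
    divergence of the integral. *)
Lemma gamma_fun_gt0 a : 0 < a -> 0 < gamma_fun a.
Proof.
move=> a0; rewrite lt_def gamma_fun_ge0 andbT; apply/eqP => g0.
have k0 : 0 < normal_peak (1 : R) by rewrite normal_peak_gt0// oner_neq0.
have := stirling_ratio_ge a0.
by rewrite /stirling_ratio gamma_funD1// g0 mulr0 mul0r leNgt invr_gt0 k0.
Qed.

End stirling.

(** * Shape greater than 1 *)

Section unit_interval.
Variable R : realType.
Notation mu := (@lebesgue_measure R).

(** Folding at 0 pairs g(y) with g(-y), the sum to which AM-GM applies. *)
Lemma integral_itvN11 (g : R -> R) : (forall y, 0 <= g y) ->
  measurable_fun setT g -> {within `[(-1)%R, 0%R], continuous g} ->
  (\int[mu]_(y in `[(-1)%R, 1%R]) (g y)%:E =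
   \int[mu]_(y in `[0%R, 1%R]) (g y + g (- y))%:E)%E.
Proof.
move=> g0 mg cg.
have mgE (D : set R) : measurable_fun D (fun y => (g y)%:E).
  by apply/measurable_EFinP; exact: measurable_funTS.
have mgN (D : set R) : measurable_fun D (fun y => (g (- y))%:E).
  by apply/measurable_EFinP; apply: measurable_funTS; exact: measurableT_comp.
rewrite (@itv_bndbnd_setU _ _ _ (BRight 0)) ?bnd_simp ?lerN10//.
rewrite ge0_integral_setU//=; last 3 first.
- exact: mgE.
- by move=> y _; rewrite lee_fin.
- apply/disj_setPS => y [] /=; rewrite !in_itv/= => /andP[_ y0] /andP[].
  by rewrite ltNge y0.
rewrite integral_itv_obnd_cbnd//.
have -> : `[(-1)%R, 0%R]%classic = `[(-1)%R, (-0)%R]%classic :> set R by rewrite oppr0.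
rewrite integration_by_substitution_oppr ?oppr0//.
rewrite addeC -ge0_integralD//=.
- by move=> y _; rewrite lee_fin.
- exact: mgE.
- by move=> y _; rewrite lee_fin.
- exact: mgN.
Qed.

End unit_interval.

Section gamma_density.
Variable R : realType.
Notation mu := (@lebesgue_measure R).
Implicit Types a b s x y : R.

(** The h(y) of the overview, for a = s^2. *)
Definition std_kernel s y : R := expR ((s ^+ 2 - 1) * ln (1 + y / s) - s * y).

Lemma gamma_pdfE a b x : 0 < x ->
  gamma_pdf a b x = gamma_integrand a b x / (gamma_fun a * b `^ a).
Proof. by move=> x0; rewrite /gamma_pdf patchE mem_set//= in_itv/= x0. Qed.

Lemma gamma_pdf_ge0 a b x : 0 <= gamma_pdf a b x.
Proof.
rewrite /gamma_pdf patchE; case: ifP => // _.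
by rewrite divr_ge0 ?mulr_ge0 ?powR_ge0 ?expR_ge0 ?gamma_fun_ge0.
Qed.

Lemma gamma_pdf_kernel s b y : 0 < b -> 0 < s -> - s < y ->
  gamma_pdf (s ^+ 2) b (b * (s ^+ 2 + s * y)) * (b * s) =
  std_kernel s y / stirling_ratio (s ^+ 2).
Proof.
move=> b0 s0 sy; have S0 : 0 < s ^+ 2 by rewrite exprn_gt0.
have u0 : 0 < 1 + y / s by rewrite -ltrBlDl sub0r ltr_pdivlMr// mulN1r.
have FE : s ^+ 2 + s * y = s ^+ 2 * (1 + y / s) by field; rewrite gt_eqF.
rewrite gamma_pdfE; last by rewrite FE !mulr_gt0.
rewrite /stirling_ratio gamma_funD1// /gamma_integrand /std_kernel.
have g0 := gamma_fun_gt0 S0.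
have -> : b * (s ^+ 2 + s * y) / b = s ^+ 2 + s * y by field; rewrite gt_eqF.
rewrite /powR !gt_eqF//; last by rewrite FE !mulr_gt0.
(* Every factor becomes an exponential in ln b, ln s and ln (1 + y/s), which leaves an identity
   between exponents. *)
set A := ln b; set L := ln (1 + y / s).
have sE : s = expR (ln s) by rewrite lnK.
have bE : b = expR A by rewrite lnK.
have lnS : ln (s ^+ 2) = 2 * ln s by rewrite lnXn// mulr_natl.
have SE : s ^+ 2 = expR (2 * ln s) by rewrite -lnS lnK.
have -> : ln (b * (s ^+ 2 + s * y)) = A + (2 * ln s + L).
  by rewrite FE lnM ?posrE ?mulr_gt0// lnM ?posrE// lnS.
rewrite lnS; set G := gamma_fun (s ^+ 2) in g0 *; pose V := (s ^+ 2 + 2^-1) * (2 * ln s) - s ^+ 2.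
rewrite -/V.
have -> : (s ^+ 2 * G / expR V)^-1 = G^-1 * expR (V - 2 * ln s).
  by rewrite (expRB V) -SE; field; rewrite !gt_eqF// expR_gt0.
have -> : (G * expR (s ^+ 2 * A))^-1 = G^-1 * expR (- (s ^+ 2 * A)) by rewrite invfM expRN.
have -> : b * s = expR (A + ln s) by rewrite expRD -bE -sE.
transitivity (G^-1 * expR ((s ^+ 2 - 1) * (A + (2 * ln s + L)) + - (s ^+ 2 + s * y)
   + - (s ^+ 2 * A) + (A + ln s))).
  by rewrite !expRD; ring.
transitivity (G^-1 * expR ((s ^+ 2 - 1) * L - s * y + (V - 2 * ln s))).
  by congr (_ * expR _); rewrite /V; field.
by rewrite expRD; ring.
Qed.

(** Substitution x = b (s^2 + s y). For s > 1 the left end is positive, so the interval lies inside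
    the support. *)
Lemma integral_gamma_pdf_itv s b : 0 < b -> 1 < s ->
  (\int[mu]_(x in `[(b * (s ^+ 2 - s))%R, (b * (s ^+ 2 + s))%R]) (gamma_pdf (s ^+ 2) b x)%:E =
   \int[mu]_(y in `[(-1)%R, 1%R]) (std_kernel s y / stirling_ratio (s ^+ 2))%:E)%E.
Proof.
move=> b0 s1; have s0 : 0 < s by lra.
pose F y : R := b * (s ^+ 2 + s * y).
have dF y : is_derive y 1 F (b * s) by rewrite /F; derive1_tac; ring.
have F'E : derive1 F = cst (b * s).
  by apply/funext => y; rewrite derive1E; have [_ ->] := dF y.
have cF : continuous F.
  by move=> y; exact: is_derive1_continuous (dF y).
have -> : b * (s ^+ 2 - s) = F (-1) by rewrite /F mulrN1.
have -> : b * (s ^+ 2 + s) = F 1 by rewrite /F mulr1.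
have F0 y : -1 <= y -> 0 < F y.
  move=> y1; rewrite /F mulr_gt0// expr2 -mulrDr mulr_gt0//; lra.
pose c := gamma_fun (s ^+ 2) * b `^ (s ^+ 2).
transitivity (\int[mu]_(x in `[(F (-1))%R, (F 1)%R]) (gamma_integrand (s ^+ 2) b x / c)%:E)%E.
  apply: eq_integral => x; rewrite inE/= in_itv/= => /andP[x1 _].
  by rewrite gamma_pdfE//; apply: lt_le_trans x1; exact: F0.
rewrite integration_by_substitution_increasing; first last.
- apply: continuous_in_subspaceT => x; rewrite inE/= in_itv/= => /andP[x1 _].
  apply: cvgMl; apply: continuous_gamma_integrand.
  by apply: lt_le_trans x1; exact: F0.
- split; first by move=> y _; have [] := dF y.
    by apply: cvg_at_right_filter; exact: cF.
  by apply: cvg_at_left_filter; exact: cF.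
- by rewrite F'E; exact: is_cvg_cst.
- by rewrite F'E; exact: is_cvg_cst.
- by rewrite F'E => y _; exact: cvg_cst.
- by move=> x y _ _ xy; rewrite /F ltr_pM2l// ltrD2l ltr_pM2l.
- by lra.
rewrite F'E; apply: eq_integral => y; rewrite inE/= in_itv/= => /andP[y1 _].
congr EFin; rewrite -(gamma_pdf_kernel b0) ?gamma_pdfE//; last lra.
exact: F0.
Qed.

End gamma_density.

(** * Comparison of the Gamma and normal densities over one standard deviation *)

Section comparison.
Variable R : realType.
Notation mu := (@lebesgue_measure R).
Implicit Types a b s y t : R.

Lemma expRN_le_taylor2 t : 0 <= t -> expR (- t) <= 1 - t + t ^+ 2 / 2.
Proof.
move=> t0.
have : 1 - 0 + 0 ^+ 2 / 2 - expR (- 0) <= 1 - t + t ^+ 2 / 2 - expR (- t).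
  apply: (@is_derive_ge0_le R (fun x => 1 - x + x ^+ 2 / 2 - expR (- x))
    (fun x => expR (- x) - (1 - x)) 0 t t0) => x /andP[x0 _].
  - by derive1_tac; field.
  - by rewrite subr_ge0 expR_ge1Dx.
by rewrite oppr0 expR0 expr0n/= mul0r !addr0 subrr subr_ge0.
Qed.

(** AM-GM: the difference is (e^(p/2) - e^(q/2))^2. *)
Lemma expR_half_sum_le (p q : R) : 2 * expR ((p + q) / 2) <= expR p + expR q.
Proof.
rewrite -subr_ge0.
have -> : expR p + expR q - 2 * expR ((p + q) / 2) = (expR (p / 2) - expR (q / 2)) ^+ 2.
  have e t : expR t = expR (t / 2) ^+ 2 by rewrite -expRM_natr divfK.
  by rewrite [(p + q) / 2]mulrDl expRD (e p) (e q); ring.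
exact: sqr_ge0.
Qed.

Lemma std_kernel_ge0 s y : 0 <= std_kernel s y.
Proof. exact: expR_ge0. Qed.

Lemma std_kernel_le s y : 1 < s -> -1 <= y <= 1 ->
  std_kernel s y <= expR (2 / s) * expR (- (y ^+ 2 / 2)).
Proof. by move=> s1 y1; rewrite -expRD ler_expR [leRHS]addrC kernel_exponent_le. Qed.

(** In the mean of the two exponents the terms s y cancel and the logarithms combine to ln (1 -
    y^2/s^2), bounded by [ln_sym_kernel_ge]. *)
Lemma std_kernel_sym_ge s y : 1 < s -> 0 <= y <= 1 ->
  2 * expR (- (y ^+ 2 / 2) + (y ^+ 2 - y ^+ 4 / 2) / (2 * s ^+ 2)) <=
  std_kernel s y + std_kernel s (- y).
Proof.
move=> s1 /andP[y0 y1]; have s0 : 0 < s by lra.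
apply: le_trans (expR_half_sum_le _ _).
rewrite ler_pM2l// ler_expR ler_pdivlMr//.
have u0 : 0 <= y / s by rewrite divr_ge0// ltW.
have u1 : y / s < 1 by rewrite ltr_pdivrMr// mul1r; lra.
rewrite [leRHS](_ : _ = (s ^+ 2 - 1) * (ln (1 + y / s) + ln (1 + - y / s))); last by ring.
rewrite mulNr -lnM ?posrE; [|lra|lra].
have -> : (1 + y / s) * (1 - y / s) = 1 - y ^+ 2 / s ^+ 2 by field; rewrite gt_eqF.
have := @ln_sym_kernel_ge R s y s1 (introT andP (conj y0 y1)).
apply: le_trans; rewrite le_eqVlt; apply/orP; left; apply/eqP.
by field; rewrite gt_eqF.
Qed.

Lemma continuous_std_kernel s y : 0 < s -> - s < y -> {for y, continuous (std_kernel s)}.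
Proof.
move=> s0 sy.
have u0 : 0 < 1 + y / s by rewrite -ltrBlDl sub0r ltr_pdivlMr// mulN1r.
by rewrite /std_kernel; eapply is_derive1_continuous; repeat derive1_step.
Qed.

Lemma measurable_std_kernel s : measurable_fun setT (std_kernel s).
Proof.
apply: measurableT_comp => //; apply: measurable_funB; last exact: measurable_funM.
apply: measurable_funM => //; apply: measurableT_comp; first exact: measurable_ln.
by apply: measurable_funD => //; exact: measurable_funM.
Qed.

Lemma continuous_gauss y : {for y, continuous (fun y => expR (- (y ^+ 2 / 2)) : R)}.
Proof.
by eapply is_derive1_continuous; repeat derive1_step.
Qed.

Lemma measurable_gauss : measurable_fun setT (fun y => expR (- (y ^+ 2 / 2)) : R).
Proof. by apply: continuous_measurable_fun => y; exact: continuous_gauss. Qed.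

Lemma integrable_itv (f : R -> R) (p q : R) : (forall y, p <= y <= q -> {for y, continuous f}) ->
  mu.-integrable `[p, q] (EFin \o f).
Proof.
move=> cf; apply: continuous_compact_integrable; first exact: segment_compact.
by apply: continuous_in_subspaceT => y; rewrite inE/= in_itv/=; exact: cf.
Qed.

Lemma integral_itv_derive (f F : R -> R) (p q : R) : p < q ->
  (forall y, is_derive y 1 F (f y)) -> continuous f ->
  (\int[mu]_(y in `[p, q]) (f y)%:E = (F q - F p)%:E)%E.
Proof.
move=> pq dF cf; rewrite EFinB; apply: continuous_FTC2 => //.
- by apply: continuous_in_subspaceT => y _; exact: cf.
- have cF : continuous F.
    by move=> y; exact: is_derive1_continuous (dF y).
  split; first by move=> y _; have [] := dF y.
    by apply: cvg_at_right_filter; exact: cF.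
  by apply: cvg_at_left_filter; exact: cF.
- by move=> y _; rewrite derive1E; have [_ ->] := dF y.
Qed.

Lemma gauss_le_taylor2 y : expR (- (y ^+ 2 / 2)) <= 1 - y ^+ 2 / 2 + y ^+ 4 / 8.
Proof.
have -> : y ^+ 4 / 8 = (y ^+ 2 / 2) ^+ 2 / 2 by field.
by apply: expRN_le_taylor2; rewrite divr_ge0 ?sqr_ge0.
Qed.

(** Fourth power of e^(-1/8) >= 1 - 1/8. The value is about 0.586; the comparison below needs more
    than 103/180, about 0.572. *)
Lemma expRN_half_ge : 7 ^+ 4 / 8 ^+ 4 <= expR (- (1 / 2)) :> R.
Proof.
have -> : - (1 / 2) = (- 8^-1) * 4%:R :> R by field.
rewrite expRM_natr -expr_div_n lerXn2r ?nnegrE ?expR_ge0 ?divr_ge0//.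
apply: le_trans (expR_ge1Dx _); lra.
Qed.

(** Integrate the Taylor majorant: 1 - 1/6 + 1/40 = 103/120. *)
Lemma integral_gauss_itv01_le :
  (\int[mu]_(y in `[0%R, 1%R]) (expR (- (y ^+ 2 / 2)))%:E <= (103 / 120)%:E)%E.
Proof.
pose F y : R := y - y ^+ 3 / 6 + y ^+ 5 / 40.
pose f y : R := 1 - y ^+ 2 / 2 + y ^+ 4 / 8.
have dF y : is_derive y 1 F (f y) by rewrite /F; derive1_tac; rewrite /f; field.
have cf : continuous f.
  by move=> y; rewrite /f; eapply is_derive1_continuous; repeat derive1_step.
have -> : 103 / 120 = F 1 - F 0 by rewrite /F; field.
rewrite -(@integral_itv_derive f F)//.
apply: le_integral => //.
- by apply: integrable_itv => y _; exact: continuous_gauss.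
- by apply: integrable_itv => y _; exact: cf.
- by move=> y _; rewrite lee_fin; exact: gauss_le_taylor2.
Qed.

Lemma normal_interval :
  (\int[mu]_(y in `[(-1)%R, 1%R]) (normal_pdf 0 1 y)%:E =
   \int[mu]_(y in `[0%R, 1%R]) (2 * normal_peak 1 * expR (- (y ^+ 2 / 2)))%:E)%E.
Proof.
rewrite integral_itvN11.
- apply: eq_integral => y _; rewrite !normal_pdf01E sqrrN; congr EFin; ring.
- exact: normal_pdf_ge0.
- exact: measurable_normal_pdf.
- by apply: continuous_in_subspaceT => y _; apply: continuous_normal_pdf; exact: oner_neq0.
Qed.

Lemma normal_lt_gamma_interval s b : 0 < b -> 1 < s ->
  (\int[mu]_(y in `[(-1)%R, 1%R]) (normal_pdf 0 1 y)%:E <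
   \int[mu]_(x in `[(b * (s ^+ 2 - s))%R, (b * (s ^+ 2 + s))%R])
     (gamma_pdf (s ^+ 2) b x)%:E)%E.
Proof.
move=> b0 s1; have s0 : 0 < s by lra.
have S0 : 0 < s ^+ 2 by rewrite exprn_gt0.
rewrite integral_gamma_pdf_itv// normal_interval.
set k := normal_peak 1; set r := stirling_ratio _.
have k0 : 0 < k by rewrite normal_peak_gt0// oner_neq0.
have r0 : 0 < r by apply: lt_le_trans (stirling_ratio_ge S0); rewrite invr_gt0.
have rV : k * expR (- (12 * s ^+ 2)^-1) <= r^-1.
  rewrite -[leRHS]mul1r ler_pdivlMr// mulrC -ler_pdivlMr ?mulr_gt0 ?expR_gt0//.
  by rewrite mul1r invfM -expRN opprK stirling_ratio_le.
rewrite integral_itvN11; last 3 first.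
- by move=> y; rewrite divr_ge0 ?std_kernel_ge0// ltW.
- by apply: measurable_funM => //; exact: measurable_std_kernel.
- apply: continuous_in_subspaceT => y; rewrite inE/= in_itv/= => /andP[y1 _].
  by apply: cvgMl; apply: continuous_std_kernel => //; lra.
pose c := k / (6 * s ^+ 2).
have c0 : 0 < c by rewrite divr_gt0// mulr_gt0.
(* f is c (6 y^2 - 3 y^4 - 1) e^(-y^2/2) with the part -4 e^(-y^2/2) replaced by a
   polynomial lower bound, so that f has the elementary primitive F. *)
pose F y : R := c * ((3 * y ^+ 3 + 3 * y) * expR (- (y ^+ 2 / 2))
  - 4 * (y - y ^+ 3 / 6 + y ^+ 5 / 40)).
pose f y : R := c * ((6 * y ^+ 2 - 3 * y ^+ 4 + 3) * expR (- (y ^+ 2 / 2))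
  - 4 * (1 - y ^+ 2 / 2 + y ^+ 4 / 8)).
have dF y : is_derive y 1 F (f y) by rewrite /F; derive1_tac; rewrite /f; field.
have cf : continuous f.
  by move=> y; rewrite /f; eapply is_derive1_continuous; repeat derive1_step.
(* The source of the strict inequality: 6 e^(-1/2) exceeds 4 * 103/120. *)
have F10 : 0 < F 1 - F 0.
  have -> : F 1 - F 0 = c * (6 * expR (- (1 / 2)) - 103 / 30).
    by rewrite /F !expr0n/= !mulr0 mul0r !expr1n; field.
  by rewrite mulr_gt0//; have := expRN_half_ge; lra.
pose g y := 2 * k * expR (- (y ^+ 2 / 2)).
have cg y : {for y, continuous g} by apply: cvgMr; exact: continuous_gauss.
have ig : mu.-integrable `[0%R, 1%R] (EFin \o g) by apply: integrable_itv => y _; exact: cg.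
(* Insert g + f, where g is the folded normal density and f a correction of positive integral,
   possibly negative at some points. *)
apply: (@lt_le_trans _ _ (\int[mu]_(y in `[0%R, 1%R]) (g y + f y)%:E)%E).
  under [ltRHS]eq_integral do rewrite EFinD.
  rewrite integralD//; last by apply: integrable_itv => y _; exact: cf.
  rewrite (@integral_itv_derive f F)//.
  by rewrite lteDl// ?lte_fin//; exact: integrable_fin_num.
apply: le_integral => //.
- by apply: integrable_itv => y _; apply: cvgD; [exact: cg|exact: cf].
- apply: integrable_itv => y /andP[y0 y1]; apply: cvgD; apply: cvgMl.
    by apply: continuous_std_kernel => //; lra.
  apply: (@continuous_comp _ _ _ -%R (std_kernel s)); first exact: opp_continuous.
  by apply: continuous_std_kernel => //; lra.
move=> y; rewrite inE/= in_itv/= => y01; rewrite lee_fin -mulrDl.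
have y0 : 0 <= y ^+ 2 by exact: sqr_ge0.
have h1 := std_kernel_sym_ge s1 y01.
apply: (@le_trans _ _ (2 * expR (- (y ^+ 2 / 2) + (y ^+ 2 - y ^+ 4 / 2) / (2 * s ^+ 2)) *
    (k * expR (- (12 * s ^+ 2)^-1)))); last first.
  by apply: ler_pM => //; rewrite !mulr_ge0 ?expR_ge0// ltW.
rewrite expRD; set G := expR (- (y ^+ 2 / 2)).
have -> : 2 * (G * expR ((y ^+ 2 - y ^+ 4 / 2) / (2 * s ^+ 2))) *
    (k * expR (- (12 * s ^+ 2)^-1)) =
    2 * k * G * expR ((6 * y ^+ 2 - 3 * y ^+ 4 - 1) / (12 * s ^+ 2)).
  have -> : (6 * y ^+ 2 - 3 * y ^+ 4 - 1) / (12 * s ^+ 2) =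
    (y ^+ 2 - y ^+ 4 / 2) / (2 * s ^+ 2) + - (12 * s ^+ 2)^-1 by field; rewrite gt_eqF.
  by rewrite expRD; ring.
have G0 : 0 < G by exact: expR_gt0.
(* e^u >= 1 + u holds for either sign of u; here 6 y^2 - 3 y^4 - 1 changes sign on [0, 1]. *)
apply: (@le_trans _ _
  (2 * k * G * (1 + (6 * y ^+ 2 - 3 * y ^+ 4 - 1) / (12 * s ^+ 2)))); last first.
  by rewrite ler_pM2l ?expR_ge1Dx// !mulr_gt0.
rewrite [leRHS](_ : _ = g y + c * ((6 * y ^+ 2 - 3 * y ^+ 4 - 1) * G)); last first.
  by rewrite /g -/G /c; field; rewrite gt_eqF.
rewrite lerD2l /f ler_pM2l// -/G.
have := gauss_le_taylor2 y; rewrite -/G; lra.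
Qed.

(** Combines [std_kernel_le] with 1/r <= k. The factor tends to 1 as s grows, which is enough for
    the infimum. *)
Lemma gamma_interval_le s b : 0 < b -> 1 < s ->
  (\int[mu]_(x in `[(b * (s ^+ 2 - s))%R, (b * (s ^+ 2 + s))%R])
     (gamma_pdf (s ^+ 2) b x)%:E <=
   (expR (2 / s))%:E * \int[mu]_(y in `[(-1)%R, 1%R]) (normal_pdf 0 1 y)%:E)%E.
Proof.
move=> b0 s1; have s0 : 0 < s by lra.
have S0 : 0 < s ^+ 2 by rewrite exprn_gt0.
rewrite integral_gamma_pdf_itv//.
set r := stirling_ratio _.
have k0 : 0 < normal_peak (1 : R) by rewrite normal_peak_gt0// oner_neq0.
have r0 : 0 < r by apply: lt_le_trans (stirling_ratio_ge S0); rewrite invr_gt0.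
have rV : r^-1 <= normal_peak 1 by rewrite invf_ple ?posrE// stirling_ratio_ge.
rewrite -ge0_integralZl//=; last 2 first.
- by apply/measurable_EFinP/measurable_funTS; exact: measurable_normal_pdf.
- by move=> y _; rewrite lee_fin normal_pdf_ge0.
apply: ge0_le_integral => //.
- by move=> y _; rewrite lee_fin divr_ge0 ?std_kernel_ge0// ltW.
- apply/measurable_EFinP/measurable_funTS; apply: measurable_funM => //.
  exact: measurable_std_kernel.
- apply/measurable_EFinP/measurable_funTS; apply: measurable_funM => //.
  exact: measurable_normal_pdf.
- move=> y; rewrite /= in_itv/= => y1; rewrite -EFinM lee_fin normal_pdf01E mulrCA mulrC.
  by apply: ler_pM; rewrite ?std_kernel_ge0 ?invr_ge0 ?std_kernel_le// ltW.
Qed.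

End comparison.

(** * Shape at most 1 *)

Section small_shape.
Variable R : realType.
Notation mu := (@lebesgue_measure R).
Implicit Types a b t x : R.

Lemma gamma_fun1 : gamma_fun (1 : R) = 1.
Proof.
rewrite gamma_funE /gamma_integral integral_itv_obnd_cbnd; last first.
  by apply/measurable_EFinP/measurable_funTS; exact: measurable_gamma_integrand.
transitivity (fine (\int[mu]_x (exponential_pdf (1 : R) x)%:E)%E); last first.
  by rewrite integral_exponential_pdf.
congr fine; rewrite integral_mkcond; apply: eq_integral => x _.
rewrite /exponential_pdf !patchE; case: ifP => // _.
by rewrite /gamma_integrand subrr powRr0 divr1 mulN1r.
Qed.

(** Stirling's upper bound at a = 1, where r(1) = e: it yields k <= e^(1/12 - 1) without any
    estimate of pi. *)
Lemma normal_peak1_le : normal_peak 1 <= expR (- (11 / 12)) :> R.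
Proof.
have k0 : 0 < normal_peak (1 : R) by rewrite normal_peak_gt0// oner_neq0.
have := @stirling_ratio_le R 1 ltr01.
have -> : stirling_ratio 1 = expR 1 :> R.
  rewrite /stirling_ratio gamma_funD1// gamma_fun1 ln1 mulr0 add0r !mul1r.
  by rewrite -expRN opprK.
rewrite -(ler_pM2l k0) mulrA divff ?gt_eqF// mul1r -ler_pdivlMr ?expR_gt0//.
by rewrite -expRB (_ : (12 * 1)^-1 - 1 = - (11 / 12))//; field.
Qed.

(** Integration by parts with exponent a - 1 <= 0: the remaining integral and the boundary term at q
    both have the favourable sign. *)
Lemma integral_gamma_integrand_tail_le a b t q : a <= 1 -> 0 < b -> 0 < t -> t < q ->
  (\int[mu]_(x in `[t, q]) (gamma_integrand a b x)%:E <= (b * gamma_integrand a b t)%:E)%E.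
Proof.
move=> a1 b0 t0 tq.
have := @integral_gamma_integrand_itv R (a - 1) b t q t0 tq.
rewrite subrK => E.
have I0 : (0 <= \int[mu]_(x in `[t, q]) (gamma_integrand (a - 1) b x)%:E)%E.
  by apply: integral_ge0 => x _; rewrite lee_fin gamma_integrand_ge0.
have If c : (\int[mu]_(x in `[t, q]) (gamma_integrand c b x)%:E)%E \is a fin_num.
  apply: integrable_fin_num => //; apply: continuous_compact_integrable.
    exact: segment_compact.
  exact: within_continuous_gamma_integrand.
move: I0 E; rewrite -(fineK (If (a - 1))) -(fineK (If a)) !lee_fin.
set A := fine _; set B := fine _ => A0 [E].
have gq := gamma_integrand_ge0 a b q.
rewrite -ler_pdivrMl//.
have h : (a - 1) * A <= 0 by rewrite mulr_le0_ge0// subr_le0.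
lra.
Qed.

(** Two integrations by parts, dropping the last integral, which is nonnegative. *)
Lemma integral_gamma_integrand_head_ge a b t : 0 < a -> 0 < b -> 0 < t ->
  ((gamma_integrand (a + 1) b t + gamma_integrand (a + 1 + 1) b t / (b * (a + 1)))%:E <=
   a%:E * \int[mu]_(x in `]0%R, t]) (gamma_integrand a b x)%:E)%E.
Proof.
move=> a0 b0 t0.
(* Boundary terms at the cutoff 1/(n+2), which vanish in the limit. *)
pose e (n : nat) : R := gamma_integrand (a + 1) b n.+2%:R^-1
  + gamma_integrand (a + 1 + 1) b n.+2%:R^-1 / (b * (a + 1)).
have a10 : 0 < a + 1 by lra.
have e0 : e @ \oo --> (0 : R).
  rewrite -[X in _ --> X]addr0 -[X in _ + X](mul0r (b * (a + 1))^-1).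
  by apply: cvgD; [exact: gamma_integrand_cvg0|apply: cvgMl; exact: gamma_integrand_cvg0].
set J := (\int[mu]_(x in `]0%R, t]) _)%E; set L := _ + _.
suff : \forall n \near \oo, ((L - e n)%:E <= a%:E * J)%E.
  move=> h; have LE : (L - e n)%:E @[n --> \oo] --> L%:E.
    apply: cvg_EFin; first exact: nearW.
    rewrite -[X in _ --> X]subr0; apply: cvgB => //; exact: cvg_cst.
  rewrite -(cvg_lim _ LE)//; apply: lime_le => //.
  by apply/cvg_ex; eexists; exact: LE.
near=> n.
have pt : n.+2%:R^-1 < t.
  have : (harmonic n : R) < t.
    near: n; have := @cvgr_lt R _ _ _ _ _ (@cvg_harmonic R) t t0; exact.
  by apply: le_lt_trans; rewrite /= lef_pV2 ?posrE// ler_nat.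
have p0 : 0 < n.+2%:R^-1 :> R by rewrite invr_gt0.
set p := n.+2%:R^-1 in pt p0.
apply: (@le_trans _ _ (a%:E * \int[mu]_(x in `[p, t]) (gamma_integrand a b x)%:E)%E); last first.
  rewrite lee_wpmul2l ?lee_fin ?(ltW a0)//; apply: ge0_subset_integral => //.
  - by apply/measurable_EFinP/measurable_funTS; exact: measurable_gamma_integrand.
  - by move=> x _; rewrite lee_fin gamma_integrand_ge0.
  - by move=> x /=; rewrite !in_itv/= => /andP[px ->]; rewrite (lt_le_trans p0).
rewrite integral_gamma_integrand_itv//.
have := @integral_gamma_integrand_itv R (a + 1) b p t p0 pt.
have If c : (\int[mu]_(x in `[p, t]) (gamma_integrand c b x)%:E)%E \is a fin_num.
  apply: integrable_fin_num => //; apply: continuous_compact_integrable.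
    exact: segment_compact.
  exact: within_continuous_gamma_integrand.
have I0 : (0 <= \int[mu]_(x in `[p, t]) (gamma_integrand (a + 1 + 1) b x)%:E)%E.
  by apply: integral_ge0 => x _; rewrite lee_fin gamma_integrand_ge0.
move: I0; rewrite -(fineK (If (a + 1 + 1))) -(fineK (If (a + 1))).
set A := fine _; set B := fine _; rewrite -!EFinM -!EFinD !lee_fin => A0 [E].
have -> : L - e n = gamma_integrand (a + 1) b t - gamma_integrand (a + 1) b p
  + b^-1 * ((gamma_integrand (a + 1 + 1) b t - gamma_integrand (a + 1 + 1) b p) / (a + 1)).
  by rewrite /L /e -/p; field; rewrite !gt_eqF.
rewrite addrC lerD2r ler_pM2l ?invr_gt0// ler_pdivrMr// mulrC E lerDr.
by rewrite mulr_ge0// invr_ge0 ltW.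
Unshelve. all: end_near. Qed.

End small_shape.

Section small_shape_interval.
Variable R : realType.
Notation mu := (@lebesgue_measure R).
Implicit Types a b s t x : R.

(** The mass is at most 2 k * 103/120 with k <= e^(-11/12). The exponential is taken as a fourth
    power so that the quadratic Taylor bound is sharp enough; the result is about 0.693. *)
Lemma normal_interval_le :
  (\int[mu]_(y in `[(-1)%R, 1%R]) (normal_pdf 0 1 y)%:E <= (7 / 10)%:E)%E.
Proof.
rewrite normal_interval.
have k0 : 0 < normal_peak (1 : R) by rewrite normal_peak_gt0// oner_neq0.
under eq_integral do rewrite EFinM.
rewrite ge0_integralZl//=; last 2 first.
- by apply/measurable_EFinP/measurable_funTS; exact: measurable_gauss.
- by rewrite lee_fin mulr_ge0// ltW.
apply: (@le_trans _ _ ((2 * normal_peak 1)%:E * (103 / 120)%:E)%E).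
  by rewrite lee_wpmul2l ?integral_gauss_itv01_le// lee_fin mulr_ge0// ltW.
rewrite -EFinM lee_fin.
have := normal_peak1_le R.
have -> : - (11 / 12) = - (11 / 48) * 4%:R :> R by field.
have t0 : 0 <= 11 / 48 :> R by lra.
have := expRN_le_taylor2 t0; rewrite expRM_natr => h1 h2.
have : expR (- (11 / 48)) ^+ 4 <= (1 - 11 / 48 + (11 / 48) ^+ 2 / 2) ^+ 4 :> R.
  by rewrite lerXn2r// nnegrE ?expR_ge0// (le_trans _ h1)// expR_ge0.
lra.
Qed.

Lemma gamma_integrandD1_mul a b x : 0 < a -> 0 < x ->
  gamma_integrand (a + 1) b x = x * gamma_integrand a b x.
Proof.
by move=> a0 x0; rewrite gamma_integrandD1 /gamma_integrand mulrA mulr_powRB1// ltW.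
Qed.

Lemma gamma_tail_le a b t : a <= 1 -> 0 < b -> 0 < t ->
  (\int[mu]_(x in `]t, +oo[) (gamma_integrand a b x)%:E <= (b * gamma_integrand a b t)%:E)%E.
Proof.
move=> a1 b0 t0.
have mg (D : set R) : measurable_fun D (fun x => (gamma_integrand a b x)%:E).
  by apply/measurable_EFinP/measurable_funTS; exact: measurable_gamma_integrand.
rewrite integral_itv_obnd_cbnd// itv_bndy_bigcup_BRight.
have h : (\int[mu]_(x in `[t, (t + n%:R)%R]) (gamma_integrand a b x)%:E)%E @[n --> \oo]
   --> (\int[mu]_(x in \bigcup_n `[t, (t + n%:R)%R]%classic) (gamma_integrand a b x)%:E)%E.
  apply: ge0_nondecreasing_set_cvg_integral => //.
  - move=> m n mn; rewrite subsetEset => x /=.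
    rewrite !in_itv/= => /andP[-> /= h]; apply: (le_trans h).
    by rewrite lerD2l ler_nat.
  - by move=> n; exact: mg.
  - by move=> n x _; rewrite lee_fin gamma_integrand_ge0.
rewrite -(cvg_lim _ h)//; apply: lime_le; first by apply/cvg_ex; eexists; exact: h.
near=> n; apply: integral_gamma_integrand_tail_le => //.
rewrite ltrDl ltr0n; near: n; exact: nbhs_infty_gt.
Unshelve. all: end_near. Qed.

Lemma gamma_tail_head s b : 0 < s <= 1 -> 0 < b ->
  (3%:E * \int[mu]_(x in `](b * (s ^+ 2 + s))%R, +oo[) (gamma_integrand (s ^+ 2) b x)%:E <=
   \int[mu]_(x in `]0%R, (b * (s ^+ 2 + s))%R]) (gamma_integrand (s ^+ 2) b x)%:E)%E.
Proof.
move=> /andP[s0 s1] b0; have S0 : 0 < s ^+ 2 by rewrite exprn_gt0.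
have S1 : s ^+ 2 <= 1 by rewrite expr_le1// ltW.
set t := b * _.
have t0 : 0 < t by rewrite mulr_gt0//; lra.
have := gamma_tail_le S1 b0 t0; have := integral_gamma_integrand_head_ge S0 b0 t0.
rewrite gamma_integrandD1_mul ?gamma_integrandD1_mul//; last lra.
set J0 := (\int[mu]_(x in `]0%R, t]) _)%E; set J1 := (\int[mu]_(x in `]t, +oo[) _)%E.
set g := gamma_integrand _ _ _ => h0 h1.
have g0 : 0 <= g by exact: gamma_integrand_ge0.
rewrite -(@lee_pmul2l _ (s ^+ 2)%:E)// ?lte_fin//.
apply: le_trans h0.
rewrite muleA -EFinM; apply: (@le_trans _ _ ((s ^+ 2 * 3)%:E * (b * g)%:E)%E).
  by rewrite lee_wpmul2l// lee_fin mulr_ge0// ltW.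
rewrite -EFinM lee_fin /t.
(* Head bound minus three times the tail bound, both scaled by s^2; what remains is 1 + 3 s^2 - s -
   s^3 >= 0 for s <= 1. *)
have -> : b * (s ^+ 2 + s) * g + b * (s ^+ 2 + s) * (b * (s ^+ 2 + s) * g) / (b * (s ^+ 2 + 1))
  = s ^+ 2 * 3 * (b * g) + b * g * s * (1 + 3 * s ^+ 2 - s - s ^+ 3) / (s ^+ 2 + 1).
  field; rewrite !gt_eqF//; lra.
rewrite lerDl divr_ge0//; last lra.
have bg0 : 0 <= b * g by rewrite mulr_ge0// ltW.
rewrite mulr_ge0//; first by rewrite mulr_ge0// ltW.
have : s ^+ 3 <= s ^+ 2 by rewrite exprS ler_piMl// ltW.
have : 0 <= (1 - s) ^+ 2 by exact: sqr_ge0.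
rewrite sqrrB; nra.
Qed.

Lemma measurable_gamma_pdf a b : measurable_fun setT (gamma_pdf a b).
Proof.
apply/(measurable_restrictT
  (fun x : R => x `^ (a - 1) * expR (- (x / b)) / (gamma_fun a * b `^ a))) => //.
apply: measurable_funTS; apply: measurable_funM => //.
exact: measurable_gamma_integrand.
Qed.

(** For s <= 1 the left end is nonpositive, so the interval contains the whole head. By
    [gamma_tail_head] the total mass 1 is at most 4/3 of the head. *)
Lemma gamma_interval_small s b : 0 < s <= 1 -> 0 < b ->
  (\int[mu]_x (gamma_pdf (s ^+ 2) b x)%:E = 1)%E ->
  ((3 / 4)%:E <= \int[mu]_(x in `[(b * (s ^+ 2 - s))%R, (b * (s ^+ 2 + s))%R])
     (gamma_pdf (s ^+ 2) b x)%:E)%E.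
Proof.
move=> s01 b0; have /andP[s0 s1] := s01.
have := gamma_tail_head s01 b0.
set t := b * (s ^+ 2 + s) => h pdf1.
have t0 : 0 < t by rewrite mulr_gt0// addr_gt0// exprn_gt0.
have mp (D : set R) : measurable_fun D (fun x => (gamma_pdf (s ^+ 2) b x)%:E).
  by apply/measurable_EFinP/measurable_funTS; exact: measurable_gamma_pdf.
have S1 : s ^+ 2 <= s by rewrite expr2 ler_piMl// ltW.
apply: (@le_trans _ _ (\int[mu]_(x in `]0%R, t]) (gamma_pdf (s ^+ 2) b x)%:E)%E); last first.
  apply: ge0_subset_integral => //.
  - exact: mp.
  - by move=> x _; rewrite lee_fin gamma_pdf_ge0.
  - move=> x /=; rewrite !in_itv/= => /andP[x0 ->]; rewrite andbT (le_trans _ (ltW x0))//.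
    by rewrite mulr_ge0_le0 ?subr_le0// ltW.
pose c := (gamma_fun (s ^+ 2) * b `^ (s ^+ 2))^-1.
have c0 : 0 < c by rewrite invr_gt0 mulr_gt0 ?gamma_fun_gt0 ?powR_gt0// exprn_gt0.
have pdfE (D : set R) : measurable D -> D `<=` `]0, +oo[ ->
    (\int[mu]_(x in D) (gamma_pdf (s ^+ 2) b x)%:E =
     c%:E * \int[mu]_(x in D) (gamma_integrand (s ^+ 2) b x)%:E)%E.
  move=> mD D0; rewrite -ge0_integralZl//=; last 3 first.
  - by apply/measurable_EFinP/measurable_funTS; exact: measurable_gamma_integrand.
  - by move=> x _; rewrite lee_fin gamma_integrand_ge0.
  - by rewrite lee_fin ltW.
  apply: eq_integral => x; rewrite inE => /D0 /=; rewrite in_itv/= andbT => x0.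
  by rewrite gamma_pdfE// mulrC.
move: pdf1.
have -> : (\int[mu]_x (gamma_pdf (s ^+ 2) b x)%:E =
   \int[mu]_(x in `]0%R, t]) (gamma_pdf (s ^+ 2) b x)%:E +
   \int[mu]_(x in `]t, +oo[) (gamma_pdf (s ^+ 2) b x)%:E)%E.
  transitivity (\int[mu]_(x in `]0%R, +oo[) (gamma_pdf (s ^+ 2) b x)%:E)%E.
    rewrite [RHS]integral_mkcond; apply: eq_integral => x _.
    rewrite patchE; case: ifPn => // x0.
    by rewrite /gamma_pdf patchE (negbTE x0).
  rewrite (@itv_bndbnd_setU _ _ _ (BRight t)) ?bnd_simp ?ltW//.
  rewrite ge0_integral_setU//=.
  - exact: mp.
  - by move=> x _; rewrite lee_fin gamma_pdf_ge0.
  - apply/disj_setPS => y [] /=; rewrite !in_itv/= andbT => /andP[_ y0].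
    by rewrite ltNge y0.
rewrite !pdfE//; last 2 first.
- by move=> x /=; rewrite !in_itv/= !andbT; exact: lt_trans.
- by move=> x /=; rewrite !in_itv/= => /andP[->].
move: h; set J0 := (\int[mu]_(x in `]0%R, t]) _)%E; set J1 := (\int[mu]_(x in `]t, +oo[) _)%E => h.
have J00 : (0 <= J0)%E by apply: integral_ge0 => x _; rewrite lee_fin gamma_integrand_ge0.
have J10 : (0 <= J1)%E by apply: integral_ge0 => x _; rewrite lee_fin gamma_integrand_ge0.
(* An infinite tail over a finite head contradicts [h]; an infinite head makes the bound trivial. *)
case: J0 J00 h => [j0| |]// J00; case: J1 J10 => [j1| |]// J10; rewrite -?EFinM ?lee_fin.
- move=> h [E]; have : c * (3 * j1) <= c * j0 by rewrite ler_pM2l.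
  lra.
- by rewrite gt0_muley ?lte_fin// leye_eq => /eqP.
- by move=> _; rewrite gt0_muley ?lte_fin.
- by move=> _; rewrite gt0_muley ?lte_fin.
Qed.

End small_shape_interval.

(** * Moments and the main theorem *)

Section density.
Context {R : realType} {d : measure_display} {T : measurableType d}.
Variables (P : probability T R) (X : {RV P >-> R}).
Notation mu := (@lebesgue_measure R).

Import HBNNSimple.

(** [has_density] speaks of sets only; simple functions and monotone convergence extend it to
    nonnegative measurable functions. *)
Lemma ge0_integral_density (f g : R -> R) : measurable_fun setT f ->
  (forall x, 0 <= f x) -> has_density X f -> measurable_fun setT g ->
  (forall x, 0 <= g x) ->
  (\int[P]_w (g (X w))%:E = \int[mu]_x (g x * f x)%:E)%E.
Proof.
move=> mf f0 Xf mg g0.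
have mEg : measurable_fun setT (EFin \o g) by exact/measurable_EFinP.
rewrite -(ge0_integral_distribution X mEg); last by move=> x; rewrite lee_fin.
pose h := nnsfun_approx measurableT mEg.
have mh n : measurable_fun setT (h n) by exact: measurable_funPT (h n).
have hg x : (h n x)%:E @[n --> \oo] --> (g x)%:E.
  by apply: (@cvg_nnsfun_approx _ _ _ _ measurableT _ mEg) => // y _; rewrite lee_fin.
have hnd x : {homo (fun n => h n x) : m n / (m <= n)%N >-> m <= n}.
  by move=> m n mn; exact/lefP/nd_nnsfun_approx.
transitivity (limn (fun n => \int[distribution P X]_x (h n x)%:E)%E).
  rewrite -monotone_convergence//.
  - by apply: eq_integral => x _; apply/esym/cvg_lim => //; exact: hg.
  - by move=> n; exact/measurable_EFinP.
  - by move=> n x _; rewrite lee_fin.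
  - by move=> x _ m n mn; rewrite lee_fin hnd.
transitivity (limn (fun n => \int[mu]_x (h n x * f x)%:E)%E); last first.
  rewrite -monotone_convergence//.
  - apply: eq_integral => x _; apply/cvg_lim => //.
    under eq_fun do rewrite EFinM.
    by rewrite EFinM; apply: cvgeZr => //; exact: hg.
  - move=> n; apply/measurable_EFinP; apply: measurable_funM; last exact: mf.
    exact: mh.
  - by move=> n x _; rewrite lee_fin mulr_ge0.
  - by move=> x _ m n mn; rewrite lee_fin ler_wpM2r// hnd.
congr (limn _); apply/funext => n.
have mf' : measurable_fun setT (EFin \o f) by exact/measurable_EFinP.
have mhy y : measurable (h n @^-1` [set y]) by exact: measurable_sfunP.
rewrite integralT_nnsfun sintegralE.
transitivity (\int[mu]_x
  (\sum_(y \in range (h n)) (y * \1_(h n @^-1` [set y]) x)%:E * (f x)%:E))%E; last first.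
  apply: eq_integral => x _; rewrite [in RHS]fimfunE EFinM -fsumEFin//.
  rewrite ge0_mule_fsuml// => y; exact: nnfun_muleindic_ge0.
rewrite ge0_integral_fsum//.
- apply: eq_fsbigr => y; rewrite inE => -[x _ <-].
  have hx0 : 0 <= h n x by [].
  under eq_integral do rewrite EFinM -muleA.
  rewrite ge0_integralZl//.
  + congr (_ * _)%E; transitivity (distribution P X (h n @^-1` [set h n x])) => //.
    rewrite Xf// [LHS]integral_mkcond; apply: eq_integral => z _.
    by rewrite muleC epatch_indic.
  + apply: emeasurable_funM => //; apply/measurable_EFinP.
    by apply: measurable_indic; exact: mhy.
  + by move=> z _; rewrite mule_ge0// lee_fin.
- move=> y; apply: emeasurable_funM => //.
  apply/measurable_EFinP; apply: measurable_funM => //.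
  by apply: measurable_indic; exact: mhy.
- by move=> y z _; rewrite mule_ge0//; [rewrite EFinM nnfun_muleindic_ge0|rewrite lee_fin].
Qed.

End density.

Lemma gamma_pdf_le0 (R : realType) (a b x : R) : x <= 0 -> gamma_pdf a b x = 0.
Proof.
move=> x0; rewrite /gamma_pdf patchE ifF//; apply/negbTE.
by rewrite notin_setE/= in_itv/= andbT; apply/negP; rewrite -leNgt.
Qed.

Section gamma_moments.
Context {R : realType} {d : measure_display} {T : measurableType d}.
Variables (P : probability T R) (X : {RV P >-> R}) (a b : R).
Hypotheses (a0 : 0 < a) (b0 : 0 < b) (Xab : gamma_rv X a b).
Notation mu := (@lebesgue_measure R).

(** No integral is computed: the law of X has total mass 1. *)
Lemma integral_gamma_pdf : (\int[mu]_x (gamma_pdf a b x)%:E = 1)%E.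
Proof. by rewrite -Xab//; exact: probability_setT. Qed.

Let c := gamma_fun a * b `^ a.

Let c_gt0 : 0 < c. Proof. by rewrite mulr_gt0 ?gamma_fun_gt0 ?powR_gt0. Qed.

(** A power of x only changes the shape, so each moment is a Gamma integral. *)
Lemma integral_gamma_pdf_moment (g : R -> R) (a' : R) :
  (forall x, 0 < x -> g x * gamma_integrand a b x = gamma_integrand a' b x) ->
  (\int[mu]_x (g x * gamma_pdf a b x)%:E = c^-1%:E * gamma_integral a' b)%E.
Proof.
move=> gE; rewrite /gamma_integral -ge0_integralZl//=; last 3 first.
- by apply/measurable_EFinP/measurable_funTS; exact: measurable_gamma_integrand.
- by move=> x _; rewrite lee_fin gamma_integrand_ge0.
- by rewrite lee_fin invr_ge0 ltW.
rewrite [RHS]integral_mkcond; apply: eq_integral => x _; rewrite patchE.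
case: ifPn => [|x0]; last by rewrite /gamma_pdf patchE (negbTE x0) mulr0.
rewrite inE/= in_itv/= andbT => x0.
by rewrite gamma_pdfE// mulrA gE// mulrC.
Qed.

Lemma gamma_integral_cst : gamma_integral a b = c%:E.
Proof.
have := @integral_gamma_pdf_moment (fun=> 1) a (fun x _ => mul1r _).
under eq_integral do rewrite mul1r.
rewrite integral_gamma_pdf => E.
by rewrite -[LHS]mul1e -(divff (lt0r_neq0 c_gt0)) EFinM -muleA -E mule1.
Qed.

(** Stated for g so as to cover the nonnegative function max(x, 0). *)
Lemma integral_gamma_pdf_moment1 (g : R -> R) : (forall x, 0 < x -> g x = x) ->
  (\int[mu]_x (g x * gamma_pdf a b x)%:E = (a * b)%:E)%E.
Proof.
move=> gE; rewrite (@integral_gamma_pdf_moment g (a + 1)); last first.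
  by move=> x x0; rewrite gE// gamma_integrandD1_mul.
rewrite gamma_integralD1// gamma_integral_cst -!EFinM; congr EFin.
by field; rewrite gt_eqF.
Qed.

Lemma integral_gamma_pdf_moment2 :
  (\int[mu]_x (x ^+ 2 * gamma_pdf a b x)%:E = ((a + 1) * a * b ^+ 2)%:E)%E.
Proof.
have a10 : 0 < a + 1 by rewrite addr_gt0.
rewrite (@integral_gamma_pdf_moment _ (a + 1 + 1)); last first.
  by move=> x x0; rewrite !gamma_integrandD1_mul// mulrA.
rewrite !gamma_integralD1// gamma_integral_cst -!EFinM; congr EFin.
by field; rewrite gt_eqF.
Qed.

Let pdfP (g : R -> R) : measurable_fun setT g -> (forall x, 0 <= g x) ->
  (\int[P]_w (g (X w))%:E = \int[mu]_x (g x * gamma_pdf a b x)%:E)%E.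
Proof.
by apply: ge0_integral_density => //; [exact: measurable_gamma_pdf|exact: gamma_pdf_ge0].
Qed.

(** The negative part contributes 0, as the density vanishes on x <= 0. *)
Lemma gamma_expectation : ('E_P[X] = (a * b)%:E)%E.
Proof.
rewrite expectation_def integralE.
have pE : (\int[P]_w ((EFin \o X)^\+ w) = (a * b)%:E)%E.
  transitivity (\int[P]_w (Num.max (X w) 0)%:E)%E.
    by apply: eq_integral => w _; rewrite funeposE /= EFin_max.
  rewrite (@pdfP (fun x => Num.max x 0)).
  - by apply: integral_gamma_pdf_moment1 => x x0; rewrite max_l// ltW.
  - exact: measurable_maxr.
  - by move=> x; rewrite le_max lexx orbT.
have nE : (\int[P]_w ((EFin \o X)^\- w) = 0)%E.
  transitivity (\int[P]_w (Num.max (- X w) 0)%:E)%E.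
    by apply: eq_integral => w _; rewrite funenegE /= EFin_max.
  rewrite (@pdfP (fun x => Num.max (- x) 0)).
  - apply: integral0_eq => x _; have [x0|x0] := leP x 0.
      by rewrite gamma_pdf_le0// mulr0.
    by rewrite max_r ?mul0r// oppr_le0 ltW.
  - by apply: measurable_maxr => //; exact: measurableT_comp.
  - by move=> x; rewrite le_max lexx orbT.
by rewrite pE nE sube0.
Qed.

Lemma gamma_variance : ('V_P[X] = (a * b ^+ 2)%:E)%E.
Proof.
rewrite /variance unlock gamma_expectation /= unlock.
set m := a * b.
transitivity (\int[P]_w ((X w - m) ^+ 2)%:E)%E; first by [].
have m0 : 0 < m by rewrite mulr_gt0.
have mp := @measurable_gamma_pdf R a b.
have p0 := @gamma_pdf_ge0 R a b.
rewrite (@pdfP (fun x => (x - m) ^+ 2)); last 2 first.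
- by apply: measurable_funX; exact: measurable_funB.
- by move=> x; exact: sqr_ge0.
set V := (\int[mu]_x _)%E.
have m2 : measurable_fun setT (fun x : R => (x - m) ^+ 2).
  by apply: measurable_funX; exact: measurable_funB.
pose x0 (x : R) := Num.max x 0.
have x00 x : 0 <= x0 x by rewrite le_max lexx orbT.
have mx0 : measurable_fun setT x0 by exact: measurable_maxr.
(* Expansion of (x - m)^2 with the cross term moved across: all integrands are nonnegative, so
   integrals add freely, and the finite right-hand side forces V to be finite. *)
have E : (V + (2 * m)%:E * (a * b)%:E = ((a + 1) * a * b ^+ 2)%:E + (m ^+ 2)%:E * 1)%E.
  rewrite -(@integral_gamma_pdf_moment1 x0); last by move=> x xp; rewrite /x0 max_l// ltW.
  rewrite -integral_gamma_pdf_moment2 -integral_gamma_pdf.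
  rewrite -!ge0_integralZl//=; last 6 first.
  - exact/measurable_EFinP.
  - by move=> x _; rewrite lee_fin.
  - by rewrite lee_fin sqr_ge0.
  - by apply/measurable_EFinP; exact: measurable_funM.
  - by move=> x _; rewrite lee_fin mulr_ge0.
  - by rewrite lee_fin mulr_ge0// ltW.
  rewrite /V -!ge0_integralD//=.
  - apply: eq_integral => x _; rewrite -!EFinM -!EFinD; congr EFin.
    have [xle0|xgt0] := leP x 0.
      by rewrite gamma_pdf_le0// !mulr0.
    by rewrite /x0 max_l ?ltW//; ring.
  - by move=> x _; rewrite lee_fin mulr_ge0 ?sqr_ge0.
  - by apply/measurable_EFinP; apply: measurable_funM => //; exact: measurable_funX.
  - by move=> x _; rewrite -EFinM lee_fin mulr_ge0 ?sqr_ge0.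
  - by apply/measurable_EFinP; exact: measurable_funM.
  - by move=> x _; rewrite lee_fin mulr_ge0 ?sqr_ge0.
  - by apply/measurable_EFinP; exact: measurable_funM.
  - by move=> x _; rewrite -EFinM lee_fin !mulr_ge0// ltW.
  - by apply/measurable_EFinP; apply: measurable_funM => //; exact: measurable_funM.
move: E; case: V => [v| |]// [E]; congr EFin.
by apply: (addIr (2 * m * (a * b))); rewrite E /m; ring.
Qed.

Lemma gamma_within_one_sd :
  P (within_one_sd X) =
  (\int[mu]_(x in `[(b * (a - Num.sqrt a))%R, (b * (a + Num.sqrt a))%R]) (gamma_pdf a b x)%:E)%E.
Proof.
rewrite -Xab//; congr (P _); apply/seteqP.
have s0 : 0 < Num.sqrt a by rewrite sqrtr_gt0.
suff E w : within_one_sd X w <-> `|X w - a * b| <= b * Num.sqrt a.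
  by split => w /=; rewrite in_itv/= E ler_distl mulrBr mulrDr (mulrC a).
rewrite /within_one_sd /= gamma_expectation gamma_variance /= lee_fin.
by rewrite sqrtrM ?(ltW a0)// sqrtr_sqr (gtr0_norm b0) (mulrC b).
Qed.

End gamma_moments.

Lemma normal_within_one (R : realType) (d : measure_display) (T : measurableType d)
    (P : probability T R) (Z : {RV P >-> R}) : std_normal_rv Z ->
  P [set w | `|Z w| <= 1] = (\int[lebesgue_measure]_(y in `[(-1)%R, 1%R]) (normal_pdf 0 1 y)%:E)%E.
Proof.
move=> hZ; rewrite -hZ//; congr (P _); apply/seteqP.
by split => w /=; rewrite in_itv/= ler_norml.
Qed.

(* Each X a b, and Z, may live on its own probability space; nothing is assumed
   of X a b when a <= 0 or b <= 0. *)
Theorem theorem1p2 (R : realType)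
    (d : R -> R -> measure_display)
    (T : forall a b : R, measurableType (d a b))
    (P : forall a b : R, probability (T a b) R)
    (X : forall a b : R, {RV (P a b) >-> R})
    (hX : forall a b : R, 0 < a -> 0 < b -> gamma_rv (X a b) a b)
    (dZ : measure_display) (TZ : measurableType dZ) (Q : probability TZ R)
    (Z : {RV Q >-> R})
    (hZ : std_normal_rv Z) :
  (forall a b : R, 0 < a -> 0 < b ->
     (Q [set w | (`|Z w| <= 1)%R] < P a b (within_one_sd (X a b)))%E) /\
  ereal_inf [set p : \bar R | exists a b : R,
               [/\ 0 < a, 0 < b & p = P a b (within_one_sd (X a b))]]
    = Q [set w | (`|Z w| <= 1)%R].
Proof.
have lt_within a b : 0 < a -> 0 < b ->
    (Q [set w | (`|Z w| <= 1)%R] < P a b (within_one_sd (X a b)))%E.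
  move=> a0 b0; rewrite (normal_within_one hZ) (gamma_within_one_sd a0 b0 (hX a b a0 b0)).
  have s0 : 0 < Num.sqrt a by rewrite sqrtr_gt0.
  have pdf1 := integral_gamma_pdf (hX a b a0 b0).
  have aE : a = Num.sqrt a ^+ 2 by rewrite sqr_sqrtr// ltW.
  move: pdf1; rewrite aE; set s := Num.sqrt a in s0 *.
  rewrite sqrtr_sqr gtr0_norm// => pdf1.
  have [s1|s1] := leP s 1; last exact: normal_lt_gamma_interval.
  apply: (le_lt_trans (normal_interval_le R)).
  apply: (@lt_le_trans _ _ (3 / 4)%:E); first by rewrite lte_fin; lra.
  by apply: gamma_interval_small => //; rewrite s0.
split => //; apply/eqP; rewrite eq_le; apply/andP; split; last first.
  by apply: le_ereal_inf_tmp => _ [a [b [a0 b0 ->]]]; exact/ltW/lt_within.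
set S := [set p | _]; set q := Q _.
(* Finiteness lets the limit of e^(2/(n+2)) pass through the product with [q]. *)
have q_fin : q \is a fin_num.
  rewrite ge0_fin_numE ?measure_ge0// /q (normal_within_one hZ).
  by rewrite (le_lt_trans (normal_interval_le R))// ltry.
have h : ((expR (2 / n.+2%:R))%:E * q)%E @[n --> \oo] --> q.
  rewrite -[X in _ --> X]mul1e; apply: cvgeZr => //.
  apply: cvg_EFin; first exact: nearW.
  rewrite -[X in _ --> X]expR0.
  apply: (@cvg_comp _ _ _ (fun n : nat => 2 / n.+2%:R) expR _ (nbhs (0 : R)));
    last exact: continuous_expR.
  change ((2 / n.+2%:R : R) @[n --> \oo] --> (0 : R)).
  rewrite -[X in _ --> X](mulr0 2); apply: cvgMr.
  by have := @cvg_harmonic R; rewrite -cvg_shiftS.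
rewrite -(cvg_lim _ h)//; apply: lime_ge; first by apply/cvg_ex; eexists; exact: h.
(* Witnesses a = (n+2)^2 and b = 1; the offset gives s > 1 for every n. *)
apply: nearW => n; pose s : R := n.+2%:R.
have s1 : 1 < s by rewrite ltr1n.
have s0 : 0 < s by lra.
have S0 : 0 < s ^+ 2 by rewrite exprn_gt0.
apply: (@le_trans _ _ (P (s ^+ 2) 1 (within_one_sd (X (s ^+ 2) 1)))).
  by apply: ereal_inf_lbound; exists (s ^+ 2), 1.
rewrite (gamma_within_one_sd S0 ltr01 (hX _ _ S0 ltr01)) sqrtr_sqr gtr0_norm//.
rewrite /q (normal_within_one hZ); exact: gamma_interval_le.
Qed.
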